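(* For every $\epsilon\in(0,1)$ there exist constants $C_\epsilon>0$ and $N_\epsilon$ such that the following holds. Let $n\ge N_\epsilon$ and let $r$ be a positive integer with $r<n$ such that $\log^{(4r)}n$ is defined and positive. Let $\mu=\mu_1\times\cdots\times\mu_r$ be a probability measure on $(\{0,1\}^n)^r$ where each $\mu_i$ is a product probability measure on $\{0,1\}^n$, and let $f\colon(\{0,1\}^n)^r\to\{0,1\}$ be an $r$-round coin-flipping protocol. Then there exist a set $B\subseteq[n]$ with $|B|\le C_\epsilon\,\frac{n(\log^\star n)^2}{\log^{(4r)}n}$ and a value $b\in\{0,1\}$ such that $I^b_B(f)\ge 1-\epsilon$. (That is, $f$ is not $\epsilon$-resilient against coalitions of size $\omega_\epsilon\!\left(\frac{n(\log^\star n)^2}{\log^{(4r)}n}\right)$.)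
   Context: $\log^{(k)}n$ denotes the $k$-fold iterated logarithm of $n$ and $\log^\star n$ the iterated-logarithm function. A product probability measure on $\{0,1\}^n$ is one under which the coordinates are independent. An $r$-round coin-flipping protocol is a map $f\colon(\{0,1\}^n)^r\to\{0,1\}$, executed in $r$ rounds as follows in the presence of a coalition $B\subseteq[n]$ of bad players: in round $i$, the players in $[n]\setminus B$ choose $\alpha^i\in\{0,1\}^{[n]\setminus B}$ according to the restriction of $\mu_i$ to $[n]\setminus B$ (independently across rounds), and then the bad players choose their bits in round $i$ as a function of $\alpha^1,\dots,\alpha^i$. Formally, a strategy for $B$ is a sequence $\pi=(\pi_1,\dots,\pi_r)$ of functions $\pi_i\colon(\{0,1\}^{[n]\setminus B})^i\to\{0,1\}^B$, where $\pi_i$ gives the bits of the bad players in round $i$. The output is $f$ applied to the resulting $r$ broadcast strings. $I^b_{\pi,B}(f)$ is the probability that $f$ outputs $b$ when $B$ follows $\pi$, and $I^b_B(f)=\sup_\pi I^b_{\pi,B}(f)$. The protocol is $\epsilon$-resilient against coalitions of size $\ell$ if there is no $B$ with $|B|\le\ell$ and $b$ with $I^b_B(f)\ge1-\epsilon$. *)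

(* Defs.v *)
From HB Require Import structures.
From mathcomp Require Import all_boot all_order all_algebra.
From mathcomp Require Import classical_sets reals exp.
From mathcomp Require Import lra.

Set Implicit Arguments.
Unset Strict Implicit.
Unset Printing Implicit Defensive.

Import Order.TTheory GRing.Theory Num.Theory.
Local Open Scope ring_scope.

Section IteratedLog.
Variable R : realType.

(* Logarithms are taken to base 2. *)
Definition log2 (x : R) : R := ln x / ln 2.

Definition ilog (k : nat) (x : R) : R := iter k log2 x.

(* [ln] is total (it is 0 outside the positive reals), so the requirement that
   every logarithm taken has a positive argument is spelled out. *)
Definition ilog_defined (k : nat) (x : R) : Prop :=
  forall j : nat, (j < k)%N -> 0 < ilog j x.

Lemma log2_le_subr1 (x : R) : 2 <= x -> log2 x <= x - 1.
Proof.
move=> x2; have x0 : 0 < x by lra.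
have h2 : 1 / 2 <= ln 2 :> R.
  have := @le_ln1Dx R (- (1 / 2)); rewrite (_ : 1 + - (1 / 2) = 2^-1); last by lra.
  by rewrite lnV ?posrE//; lra.
have h3 : ln x - ln 2 <= (x - 2) / 2.
  rewrite -ln_div ?posrE//.
  rewrite (_ : x / 2 = 1 + (x - 2) / 2); last by lra.
  by apply: le_ln1Dx; lra.
rewrite /log2 ler_pdivrMr; last by lra.
by nra.
Qed.

Lemma ilog_eventually_le1 (x : R) : exists k : nat, ilog k x <= 1.
Proof.
have H (m : nat) : forall y : R, y <= m%:R + 1 -> exists k : nat, ilog k y <= 1.
  elim: m => [|m IH] y; first by rewrite add0r => y1; exists 0%N.
  move=> ym; have [y2|y2] := leP y 2.
    exists 1%N; rewrite /ilog /= /log2.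
    have l2 : 0 < ln 2 :> R by apply: ln_gt0; lra.
    rewrite ler_pdivrMr// mul1r.
    have [y0|y0] := leP y 0; first by rewrite ln0// ltW.
    by rewrite ler_ln ?posrE.
  have [k hk] : exists k : nat, ilog k (log2 y) <= 1.
    apply: IH; apply: (le_trans (log2_le_subr1 (ltW y2))).
    by move: ym; rewrite -[m.+1%:R]natr1; lra.
  by exists k.+1; rewrite /ilog iterSr.
apply: (H (Num.bound x)); have [x0|x0] := leP x 0.
  by apply: (le_trans x0); rewrite addr_ge0.
by have := archi_boundP (ltW x0); lra.
Qed.

Definition logstar (x : R) : nat := ex_minn (ilog_eventually_le1 x).

End IteratedLog.

Definition bits (I : finType) : finType := {ffun I -> bool}.

Section FiniteProbability.
Variable R : realType.

Record fdist (T : finType) := FDist {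
  pmf :> {ffun T -> R};
  pmf_ge0 : forall x, 0 <= pmf x;
  pmf_sum1 : \sum_x pmf x = 1 }.

Definition Pr (T : finType) (mu : fdist T) (E : pred T) : R :=
  \sum_(x | E x) mu x.

(* The coordinates are mutually independent.  The product rule over
   subfamilies is the case where some of the [A i] are everything. *)
Definition product_measure (I : finType) (mu : fdist (bits I)) : Prop :=
  forall A : I -> pred bool,
    Pr mu (fun x => [forall i, A i (x i)]) =
    \prod_i Pr mu (fun x => A i (x i)).

End FiniteProbability.

Section CoinFlipping.
Variables (R : realType) (n r : nat).

Definition protocol := {ffun 'I_r -> bits 'I_n} -> bool.

Variable B : {set 'I_n}.

Definition good : finType := {i : 'I_n | i \notin B}.
Definition bad : finType := {i : 'I_n | i \in B}.

Definition restrict (x : bits 'I_n) : bits good :=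
  [ffun i : good => x (val i)].

Definition combine (a : bits good) (c : bits bad) : bits 'I_n :=
  [ffun i : 'I_n => match boolP (i \in B) with
                    | AltTrue iB => c (exist _ i iB)
                    | AltFalse iNB => a (exist _ i iNB)
                    end].

Definition restricted_measure (mu : fdist R (bits 'I_n)) (a : bits good) : R :=
  Pr mu (fun x => restrict x == a).

(* Rounds are numbered from 0, so in round [i] the bad players have seen the
   [i.+1] honest strings of rounds 0, ..., i. *)
Definition strategy :=
  forall i : 'I_r, {ffun 'I_i.+1 -> bits good} -> bits bad.

Definition history (a : {ffun 'I_r -> bits good}) (i : 'I_r) :
    {ffun 'I_i.+1 -> bits good} :=
  [ffun j : 'I_i.+1 => a (widen_ord (ltn_ord i) j)].

Definition transcript (s : strategy) (a : {ffun 'I_r -> bits good}) :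
    {ffun 'I_r -> bits 'I_n} :=
  [ffun i : 'I_r => combine (a i) (s i (history a i))].

Definition influence_of (mu : 'I_r -> fdist R (bits 'I_n)) (f : protocol)
    (b : bool) (s : strategy) : R :=
  \sum_(a : {ffun 'I_r -> bits good} | f (transcript s a) == b)
    \prod_(i < r) restricted_measure (mu i) (a i).

Definition influence (mu : 'I_r -> fdist R (bits 'I_n)) (f : protocol)
    (b : bool) : R :=
  sup (range (influence_of mu f b)).

End CoinFlipping.

(* Main.v *)
Require Import Defs.
From mathcomp Require Import boolp classical_sets reals exp.
From mathcomp Require Import all_boot all_order all_algebra.
From mathcomp Require Import ring lra zify.

Set Implicit Arguments.
Unset Strict Implicit.
Unset Printing Implicit Defensive.

Import Order.TTheory GRing.Theory Num.Theory.
Local Open Scope ring_scope.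

(* One round.  Call a coordinate sparse when one of its two values is rarer than
   1/Th, and dense otherwise.  Fix a target set A, and let g_B(x) say that the
   coalition B can move x into A.  A random coalition B of growing size gains at
   most 1 in total, so on average over B the sum over i of what player i would
   add to g_B is bounded.  Hence raising sparse coordinates to their rare values
   almost never increases g, and, after a bounded set Z of players is added to
   B, no dense coordinate has a noticeable influence.  Choose the size of B and
   the number of raised coordinates T at a scale where g has almost stopped
   changing.  Averaged over B and T, g is then nearly Boolean by comparison with
   unions of independent copies, and its variance is small: by Efron-Stein on
   the sparse coordinates, and by a Kahn-Kalai-Linial type inequality on the
   dense ones.  So its mean is near 1, and a random coalition forces A with
   probability bounded below independently of n, or near 0, and A is rare under
   one distribution, obtained from the input by raising coordinates, which does
   not depend on A.

   Many rounds.  Induct on the number of rounds, the hypothesis being that a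
   random coalition controls every protocol with probability at least 1/kap.
   Each first-round string x is then good for a 1/kap fraction of the coalitions
   J, so many J are good for a non-rare set of x, and that set can be forced.
   One round costs four exponentials in kap. *)


(** * Expectations under weights on finite types *)

Section WeightedSums.
Variables (R : realFieldType) (T : finType).
Implicit Types w F G : T -> R.

Definition E w F : R := \sum_t w t * F t.

Definition dist w : Prop := (forall t, 0 <= w t) /\ \sum_t w t = 1.

Lemma E_lin w a F G : E w (fun t => a * F t + G t) = a * E w F + E w G.
Proof.
by rewrite /E mulr_sumr -big_split; apply: eq_bigr => t _ /=; ring.
Qed.

Lemma ED w F G : E w (fun t => F t + G t) = E w F + E w G.
Proof. by rewrite /E -big_split; apply: eq_bigr => t _ /=; rewrite mulrDr. Qed.

Lemma EB w F G : E w (fun t => F t - G t) = E w F - E w G.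
Proof. by rewrite /E -sumrB; apply: eq_bigr => t _; rewrite mulrBr. Qed.

Lemma EZ w a F : E w (fun t => a * F t) = a * E w F.
Proof. by rewrite /E mulr_sumr; apply: eq_bigr => t _; rewrite mulrCA. Qed.

Lemma E_sum (I : Type) (s : seq I) (P : pred I) w (F : I -> T -> R) :
  E w (fun t => \sum_(i <- s | P i) F i t) = \sum_(i <- s | P i) E w (F i).
Proof. by rewrite /E exchange_big; apply: eq_bigr => t _; rewrite mulr_sumr. Qed.

Lemma E_le w F G : (forall t, 0 <= w t) -> (forall t, F t <= G t) -> E w F <= E w G.
Proof. by move=> w0 FG; apply: ler_sum => t _; apply: ler_wpM2l. Qed.

Lemma E_ge0 w F : (forall t, 0 <= w t) -> (forall t, 0 <= F t) -> 0 <= E w F.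
Proof. by move=> w0 F0; apply: sumr_ge0 => t _; apply: mulr_ge0. Qed.

Lemma E_cst w c : dist w -> E w (fun=> c) = c.
Proof. by case=> _ w1; rewrite /E -mulr_suml w1 mul1r. Qed.

Lemma E_lec w F c : dist w -> (forall t, F t <= c) -> E w F <= c.
Proof. by move=> dw Fc; rewrite -[leRHS](E_cst c dw); apply: E_le => //; case: dw. Qed.

Lemma E_abs w F : (forall t, 0 <= w t) -> `|E w F| <= E w (fun t => `|F t|).
Proof.
move=> w0; apply: le_trans (ler_norm_sum _ _ _) _.
by apply: ler_sum => t _; rewrite normrM ger0_norm.
Qed.

End WeightedSums.

Lemma E_swap (R : realFieldType) (S T : finType) (v : S -> R) (w : T -> R) F :
  E v (fun s => E w (fun t => F s t)) = E w (fun t => E v (fun s => F s t)).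
Proof.
rewrite /E; under eq_bigr do rewrite mulr_sumr.
rewrite exchange_big; apply: eq_bigr => t _; rewrite mulr_sumr.
by apply: eq_bigr => s _; rewrite mulrCA.
Qed.

(** Stated for any positive linear functional, so that it covers expectations, the conditional
    expectation [Es s] at a point, and expectations weighted by [|d|]. The proof is nonnegativity of
    the quadratic a -> L((F - aG)^2). *)
Lemma cauchy_schwarz (R : realFieldType) (T : Type) (L : (T -> R) -> R) (F G : T -> R) :
    (forall a F G, L (fun t => a * F t + G t) = a * L F + L G) ->
    (forall F, (forall t, 0 <= F t) -> 0 <= L F) ->
  L (fun t => F t * G t) ^+ 2 <= L (fun t => F t ^+ 2) * L (fun t => G t ^+ 2).
Proof.
move=> Llin Lpos; set A := L (fun t => F t ^+ 2); set C := L (fun t => G t ^+ 2).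
set B := L _.
have key a : 0 <= A - 2 * a * B + a ^+ 2 * C.
  have : 0 <= L (fun t => (F t - a * G t) ^+ 2) by apply: Lpos => t; apply: sqr_ge0.
  rewrite (_ : (fun t => _) = fun t => (- 2 * a) * (F t * G t)
     + (a ^+ 2 * (G t ^+ 2) + F t ^+ 2)); last by apply/funext => t; ring.
  by rewrite !Llin -/A -/B -/C => h; lra.
have C0 : 0 <= C by apply: Lpos => t; apply: sqr_ge0.
have [C_gt0|] := ltP 0 C.
  have := key (B / C); rewrite (_ : _ + _ = (A * C - B ^+ 2) / C); last by field; lra.
  by rewrite pmulr_lge0 ?invr_gt0// subr_ge0.
move=> C_le0; have {C0 C_le0} C0 : C = 0 by apply/eqP; rewrite eq_le C0 C_le0.
have [->|B0] := eqVneq B 0; first by rewrite C0 expr0n /= mulr0.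
(* With [C = 0] the quadratic is affine in [a]; this [a] makes it equal to -1. *)
have := key ((A + 1) / (2 * B)); rewrite C0 (_ : _ + _ = - 1); first by lra.
by field; rewrite ?B0 ?pnatr_eq0.
Qed.

(** * Noise and variance on product spaces *)

Section ProductSpace.
Variables (R : realFieldType) (n : nat) (p : 'I_n -> bool -> R).
Hypothesis p_ge0 : forall i b, 0 <= p i b.
Hypothesis p_sum1 : forall i, p i true + p i false = 1.
Local Notation X := (bits 'I_n).
Implicit Types (x y : X) (i j l : 'I_n) (s : seq 'I_n) (F G H : X -> R).

Definition upd x i b : X := [ffun j => if j == i then b else x j].

Lemma updC x i j b c : i != j -> upd (upd x i b) j c = upd (upd x j c) i b.
Proof.
move=> ij; apply/ffunP => k; rewrite !ffunE.
by case: (eqVneq k j) => // ->; rewrite eq_sym (negPf ij).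
Qed.

Lemma upd_same x i b c : upd (upd x i b) i c = upd x i c.
Proof. by apply/ffunP => k; rewrite !ffunE; case: eqP. Qed.

Lemma upd_id x i : upd x i (x i) = x.
Proof. by apply/ffunP => k; rewrite !ffunE; case: eqP => // ->. Qed.

Definition wt x : R := \prod_i p i (x i).

Lemma wt_ge0 x : 0 <= wt x.
Proof. exact: prodr_ge0. Qed.

Lemma wt_dist : dist wt.
Proof.
split; first exact: wt_ge0.
rewrite (_ : \sum_x _ = \prod_i \sum_b p i b); last by rewrite bigA_distr_bigA.
by rewrite big1// => i _; rewrite big_bool /= p_sum1.
Qed.

Local Notation Ex := (E wt).

Definition Ei i F : X -> R := fun x => p i true * F (upd x i true) + p i false * F (upd x i false).

Definition Di i F : X -> R := fun x => F (upd x i true) - F (upd x i false).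

Definition inv i F := forall x b, F (upd x i b) = F x.

Lemma wt_upd x i b : wt (upd x i b) * p i (x i) = wt x * p i b.
Proof.
rewrite /wt (bigD1 i)//= [in RHS](bigD1 i)//= ffunE eqxx.
rewrite (eq_bigr (fun j => p j (x j))); first by ring.
by move=> j ji; rewrite ffunE (negPf ji).
Qed.

(** Resampling one coordinate preserves the product measure: exchanging the old bit with the fresh
    one is an involution on the pairs (x, b) that preserves the weight [wt x * p i b]. *)
Lemma Ex_Ei i F : Ex (Ei i F) = Ex F.
Proof.
have -> : Ex (Ei i F) = \sum_(z : X * bool) wt z.1 * p i z.2 * F (upd z.1 i z.2).
  rewrite /E -(pair_bigA _ (fun x b => wt x * p i b * F (upd x i b))) /=.
  by apply: eq_bigr => x _; rewrite big_bool /Ei /=; ring.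
rewrite (reindex_inj (h := fun z : X * bool => (upd z.1 i z.2, z.1 i))) /=; last first.
  apply: (@can_inj _ _ _ (fun z : X * bool => (upd z.1 i z.2, z.1 i))) => -[x b] /=.
  by rewrite upd_same upd_id ffunE eqxx.
rewrite (eq_bigr (fun z : X * bool => wt z.1 * p i z.2 * F z.1)); last first.
  by move=> [x b] _ /=; rewrite wt_upd upd_same upd_id.
rewrite -(pair_bigA _ (fun x b => wt x * p i b * F x)) /=.
apply: eq_bigr => x _; rewrite big_bool /=.
by rewrite -[RHS]mulr1 -(p_sum1 i); ring.
Qed.

Lemma Ei_lin i a F G : Ei i (fun x => a * F x + G x) = fun x => a * Ei i F x + Ei i G x.
Proof. by apply/funext => x; rewrite /Ei; ring. Qed.

Lemma EiB i F G : Ei i (fun x => F x - G x) = fun x => Ei i F x - Ei i G x.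
Proof. by apply/funext => x; rewrite /Ei; ring. Qed.

Lemma Ei_le i F G x : (forall y, F y <= G y) -> Ei i F x <= Ei i G x.
Proof. by move=> FG; apply: lerD; apply: ler_wpM2l. Qed.

Lemma Ei_ge0 i F x : (forall y, 0 <= F y) -> 0 <= Ei i F x.
Proof. by move=> F0; rewrite addr_ge0// mulr_ge0. Qed.

Lemma inv_Ei i F : inv i (Ei i F).
Proof. by move=> x b; rewrite /Ei !upd_same. Qed.

Lemma Ei_inv i F : inv i F -> Ei i F = F.
Proof. by move=> h; apply/funext => x; rewrite /Ei !h -mulrDl p_sum1 mul1r. Qed.

Lemma EiM i F G : inv i F -> Ei i (fun x => F x * G x) = fun x => F x * Ei i G x.
Proof. by move=> h; apply/funext => x; rewrite /Ei !h; ring. Qed.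

Lemma inv_EiC i j F : inv i F -> inv i (Ei j F).
Proof.
move=> h; have [->|ij] := eqVneq i j; first exact: inv_Ei.
by move=> x b; rewrite /Ei !(updC _ _ _ ij) !h.
Qed.

Lemma EiC i j F : Ei i (Ei j F) = Ei j (Ei i F).
Proof.
have [->//|ij] := eqVneq i j.
by apply/funext => x; rewrite /Ei !(updC _ _ _ ij); ring.
Qed.

Lemma DiC i j F : i != j -> Di i (Ei j F) = Ei j (Di i F).
Proof.
by move=> ij; apply/funext => x; rewrite /Ei /Di !(updC _ _ _ ij); ring.
Qed.

Lemma EiK i F : Ei i (Ei i F) = Ei i F.
Proof. exact/Ei_inv/inv_Ei. Qed.

(** Conditional expectation is an orthogonal projection: [Ei i G] is constant in coordinate [i], so
    [F] may first be averaged over it. *)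
Lemma Ei_adj i F G : Ex (fun x => F x * Ei i G x) = Ex (fun x => Ei i F x * Ei i G x).
Proof.
rewrite -(Ex_Ei i) (_ : (fun x => F x * _) = fun x => Ei i G x * F x); last first.
  by apply/funext => x; rewrite mulrC.
by rewrite EiM; [congr E; apply/funext => x; rewrite mulrC | exact: inv_Ei].
Qed.

Lemma Ei_sqr i F x : Ei i F x ^+ 2 <= Ei i (fun y => F y ^+ 2) x.
Proof.
rewrite /Ei; have := p_sum1 i; have := p_ge0 i true; have := p_ge0 i false.
set a := p i true; set b := p i false; set u := F _; set v := F _ => b0 a0 ab.
rewrite -subr_ge0 (_ : _ - _ = a * b * (u - v) ^+ 2).
  by apply: mulr_ge0 (sqr_ge0 _); apply: mulr_ge0.
have -> : b = 1 - a by lra.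
by ring.
Qed.

Lemma Ei_norm i F x : `|Ei i F x| <= Ei i (fun y => `|F y|) x.
Proof.
apply: le_trans (ler_normD _ _) _.
by rewrite !normrM !(ger0_norm (p_ge0 _ _)).
Qed.

Lemma var_Ei i F : Ex (fun x => (F x - Ei i F x) ^+ 2) =
  Ex (fun x => p i true * p i false * Di i F x ^+ 2).
Proof.
rewrite -(Ex_Ei i); congr E; apply/funext => x; rewrite /Ei /Di !upd_same.
have -> : p i true = 1 - p i false by have := p_sum1 i; lra.
by ring.
Qed.

Fixpoint Es s F : X -> R := if s is l :: s' then Es s' (Ei l F) else F.

Lemma Ex_Es s F : Ex (Es s F) = Ex F.
Proof. by elim: s F => //= l s IH F; rewrite IH Ex_Ei. Qed.

Lemma Es_lin s a F G x : Es s (fun x => a * F x + G x) x = a * Es s F x + Es s G x.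
Proof. by elim: s F G => //= l s IH F G; rewrite Ei_lin IH. Qed.

Lemma Es_ge0 s F x : (forall y, 0 <= F y) -> 0 <= Es s F x.
Proof. by elim: s F => //= l s IH F F0; apply: IH => y; apply: Ei_ge0. Qed.

Lemma Es_le s F G x : (forall y, F y <= G y) -> Es s F x <= Es s G x.
Proof. by elim: s F G => //= l s IH F G FG; apply: IH => y; apply: Ei_le. Qed.

Lemma Es_inv s i F : inv i F -> inv i (Es s F).
Proof. by elim: s F => //= l s IH F h; apply: IH; apply: inv_EiC. Qed.

Lemma Es_invs s i F : i \in s -> inv i (Es s F).
Proof.
elim: s F => //= l s IH F; rewrite in_cons => /orP[/eqP ->|/IH//].
exact/Es_inv/inv_Ei.
Qed.

Lemma inv_all F x y : (forall i, inv i F) -> F x = F y.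
Proof.
move=> h; pose z s := foldr (fun i z => upd z i (y i)) x s.
have Fz s : F (z s) = F x by elim: s => //= i s <-; rewrite h.
rewrite -(Fz (enum 'I_n)); congr F; apply/ffunP => j.
have zE s : z s j = if j \in s then y j else x j.
  by elim: s => //= i s IH; rewrite ffunE in_cons IH; case: (eqVneq j i) => [->|].
by rewrite zE mem_enum.
Qed.

Lemma Es_enum F x : Es (enum 'I_n) F x = Ex F.
Proof.
rewrite -(Ex_Es (enum 'I_n)) -(E_cst (Es (enum 'I_n) F x) wt_dist).
congr E; apply/funext => y; apply: inv_all => i; apply: Es_invs.
by rewrite mem_enum.
Qed.

(** * Noise operators and hypercontractivity *)

Definition T1 (sg : 'I_n -> R) l F : X -> R := fun x => sg l * F x + (1 - sg l) * Ei l F x.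

(** For rates in [0, 1], coordinate [l] is kept with probability [sg l] and resampled otherwise.
    Rates depend on the coordinate so that those outside the dense set can be resampled outright. *)
Fixpoint Ts sg s F : X -> R := if s is l :: s' then Ts sg s' (T1 sg l F) else F.

Lemma EiT1 sg i l F : Ei i (T1 sg l F) = T1 sg l (Ei i F).
Proof.
apply/funext => x; rewrite /T1 /= -(EiC i) /Ei /=.
by ring.
Qed.

Lemma EiTs sg i s F : Ei i (Ts sg s F) = Ts sg s (Ei i F).
Proof. by elim: s F => //= l s IH F; rewrite IH EiT1. Qed.

Lemma T1C sg tau i j F : T1 sg i (T1 tau j F) = T1 tau j (T1 sg i F).
Proof. by apply/funext => x; rewrite {1}/T1 [in RHS]/T1 !EiT1 /T1 (EiC j i); ring. Qed.

Lemma T1Ts sg tau i s F : T1 sg i (Ts tau s F) = Ts tau s (T1 sg i F).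
Proof. by elim: s F => //= l s IH F; rewrite IH T1C. Qed.

Lemma Ts_B sg s F G : Ts sg s (fun x => F x - G x) = fun x => Ts sg s F x - Ts sg s G x.
Proof.
elim: s F G => //= l s IH F G; rewrite -IH; congr Ts; apply/funext => x.
by rewrite /T1 EiB; ring.
Qed.

Lemma DiTs sg i s F : i \notin s -> Di i (Ts sg s F) = Ts sg s (Di i F).
Proof.
elim: s F => //= l s IH F; rewrite in_cons negb_or => /andP[il /IH ->].
congr Ts; apply/funext => x; rewrite /T1 -DiC// /Di; ring.
Qed.

Lemma T1_adj sg i F G : Ex (fun x => F x * T1 sg i G x) = Ex (fun x => T1 sg i F x * G x).
Proof.
have -> : (fun x => F x * T1 sg i G x) =
    fun x => sg i * (F x * G x) + (1 - sg i) * (F x * Ei i G x).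
  by apply/funext => x; rewrite /T1; ring.
have -> : (fun x => T1 sg i F x * G x) =
    fun x => sg i * (F x * G x) + (1 - sg i) * (G x * Ei i F x).
  by apply/funext => x; rewrite /T1; ring.
rewrite !E_lin !EZ Ei_adj [in RHS]Ei_adj; congr (_ + _ * E _ _).
by apply/funext => x; rewrite mulrC.
Qed.

Lemma Ts_adj sg s F G : Ex (fun x => F x * Ts sg s G x) = Ex (fun x => Ts sg s F x * G x).
Proof.
elim: s F G => //= l s IH F G; rewrite IH.
by rewrite T1_adj T1Ts.
Qed.

Lemma T1_M sg tau i F : T1 sg i (T1 tau i F) = T1 (fun l => sg l * tau l) i F.
Proof. by apply/funext => x; rewrite /T1 -/(T1 _ _ _) EiT1 /T1 EiK; ring. Qed.

Lemma Ts_M sg tau s F : Ts sg s (Ts tau s F) = Ts (fun l => sg l * tau l) s F.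
Proof. by elim: s F => //= l s IH F; rewrite T1Ts IH T1_M. Qed.

Lemma T1_sqr sg i F : 0 <= sg i <= 1 ->
  Ex (fun x => T1 sg i F x ^+ 2) <= Ex (fun x => F x ^+ 2).
Proof.
move=> /andP[s0 s1].
apply: (@le_trans _ _ (Ex (fun x => sg i * F x ^+ 2 + (1 - sg i) * Ei i (fun y => F y ^+ 2) x))).
  apply: E_le => [|x]; first exact: wt_ge0.
  apply: (@le_trans _ _ (sg i * F x ^+ 2 + (1 - sg i) * Ei i F x ^+ 2)).
    rewrite /T1 -subr_ge0 (_ : _ - _ = sg i * (1 - sg i) * (F x - Ei i F x) ^+ 2).
      by apply: mulr_ge0 (sqr_ge0 _); apply: mulr_ge0; rewrite ?subr_ge0.
    by ring.
  by rewrite lerD2l ler_wpM2l ?subr_ge0// Ei_sqr.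
by rewrite E_lin EZ Ex_Ei -mulrDl addrC subrK mul1r.
Qed.

Lemma Ts_sqr sg s F : (forall l, 0 <= sg l <= 1) ->
  Ex (fun x => Ts sg s F x ^+ 2) <= Ex (fun x => F x ^+ 2).
Proof.
move=> sg01; elim: s F => //= l s IH F.
exact: le_trans (IH _) (T1_sqr _ _).
Qed.

Lemma Ts_quad sg s F : (forall l, 0 <= sg l <= 1) ->
  Ex (fun x => F x * Ts sg s F x) <= Ex (fun x => F x ^+ 2).
Proof.
move=> sg01; have h := Ts_sqr s F sg01.
apply: (@le_trans _ _ (Ex (fun x => 2^-1 * F x ^+ 2 + 2^-1 * Ts sg s F x ^+ 2))).
  apply: E_le => [|x]; first exact: wt_ge0.
  rewrite -subr_ge0 (_ : _ - _ = 2^-1 * (F x - Ts sg s F x) ^+ 2).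
    by rewrite mulr_ge0 ?invr_ge0// sqr_ge0.
  by field.
by rewrite E_lin EZ; lra.
Qed.

(** Peel off one coordinate: with [D = F - Ei l F], [T1 sg l F] is [F] minus [1 - sg l] times [D].
    Since [Ei l F] is orthogonal to [Ts sg s D], the loss due to [l] is [1 - sg l] times the inner
    product of [D] and [Ts sg s D], which is at most the second moment of [D]. *)
Lemma noise_loss sg s F : (forall l, 0 <= sg l <= 1) ->
  Ex (fun x => F x ^+ 2) - Ex (fun x => F x * Ts sg s F x) <=
  \sum_(l <- s) (1 - sg l) * Ex (fun x => (F x - Ei l F x) ^+ 2).
Proof.
move=> sg01; elim: s => [|l s IH]; first by rewrite big_nil /= subrr.
rewrite big_cons /=; set D := (fun x => F x - Ei l F x).
have -> : Ex (fun x => F x * Ts sg s (T1 sg l F) x) =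
   Ex (fun x => F x * Ts sg s F x) - (1 - sg l) * Ex (fun x => D x * Ts sg s D x).
  have -> : Ex (fun x => D x * Ts sg s D x) = Ex (fun x => F x * Ts sg s D x).
    have -> : Ex (fun x => D x * Ts sg s D x) =
       Ex (fun x => F x * Ts sg s D x) - Ex (fun x => Ei l F x * Ts sg s D x).
      by rewrite -EB; congr E; apply/funext => x; rewrite /D; ring.
    rewrite (_ : Ex (fun x => Ei l F x * _) = 0) ?subr0//.
    have -> : (fun x => Ei l F x * Ts sg s D x) = (fun x => Ts sg s D x * Ei l F x).
      by apply/funext => x; rewrite mulrC.
    rewrite Ei_adj EiTs /D EiB EiK.
    have -> : (fun x => Ei l F x - Ei l F x) = (fun x => 0 * Ei l F x + 0).
      by apply/funext => x; ring.
    rewrite (_ : Ts _ _ _ = fun=> 0); first by rewrite /E big1// => x _; rewrite !mul0r mulr0.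
    elim: s {IH} => [|k s IH] /=; first by apply/funext => x; ring.
    rewrite -[RHS]IH; congr Ts; apply/funext => x; rewrite /T1 /Ei; ring.
  rewrite -EZ -EB; congr E; apply/funext => x.
  have -> : T1 sg l F = fun x => F x - (1 - sg l) * D x.
    by apply/funext => z; rewrite /T1 /D; ring.
  rewrite Ts_B mulrBr; congr (_ - _).
  rewrite mulrCA; congr (_ * _).
  have cD c : Ts sg s (fun x => c * D x) = fun x => c * Ts sg s D x.
    elim: s {IH x} D => //= k s IH D; rewrite -IH; congr Ts; apply/funext => x.
    by rewrite /T1 /Ei; ring.
  by rewrite cD.
have := Ts_quad s D sg01.
have : 0 <= 1 - sg l by rewrite subr_ge0; case/andP: (sg01 l).
move: IH; set a := Ex _; set b := Ex _; set c := Ex _; set d := Ex _ => h1 h2 h3.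
by have := ler_wpM2l h2 h3; lra.
Qed.


Local Notation vr l := (p l true * p l false).

(** Two-point case of Bonami's lemma. With mean [a] and derivative [b], the right side is the square
    of the second moment a^2 + v b^2, expanded so that the induction can treat [a] and [b] as
    functions of the other coordinates. The bound on [sg l ^+ 3] absorbs the third and fourth
    moments of a biased bit. *)
Lemma T1_four sg l F x : 0 <= sg l -> sg l <= 2^-1 -> 3 * sg l ^+ 3 <= vr l ->
  Ei l (fun y => T1 sg l F y ^+ 4) x <=
  Ei l F x ^+ 4 + 2 * vr l * (Ei l F x ^+ 2 * Di l F x ^+ 2) + vr l ^+ 2 * Di l F x ^+ 4.
Proof.
move=> s0 s2 s3; rewrite /T1 {1}/Ei !inv_Ei.
set a := Ei l F x; set b := Di l F x.
have aE : a = p l true * F (upd x l true) + p l false * F (upd x l false) by [].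
have bE : b = F (upd x l true) - F (upd x l false) by [].
move: (p_ge0 l true) (p_ge0 l false) (p_sum1 l) s3 aE bE; clearbody a b.
move: s0 s2; set s := sg l; clearbody s; set t := p l true; set f := p l false.
set U := F _; set V := F _; clearbody t f U V; move=> s0 s2 t0 f0 tf s3 aE bE.
have fE : f = 1 - t by lra.
have UE : U = a + f * b by rewrite aE bE fE; ring.
have VE : V = a - t * b by rewrite aE bE fE; ring.
have v0 : 0 <= t * f by rewrite mulr_ge0.
rewrite UE VE -subr_ge0; set c := f - t.
(* The bias [c] produces an odd term in [a * b], which is completed to the square of [a - c * b];
   every remaining coefficient is nonnegative under the hypotheses. *)
have -> : a ^+ 4 + 2 * (t * f) * (a ^+ 2 * b ^+ 2) + (t * f) ^+ 2 * b ^+ 4 -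
   (t * (s * (a + f * b) + (1 - s) * a) ^+ 4 + f * (s * (a - t * b) + (1 - s) * a) ^+ 4) =
   t * f * b ^+ 2 * (2 * s ^+ 3 * ((a - c * b) ^+ 2 + (1 - c ^+ 2) * b ^+ 2) +
     (2 - 6 * s ^+ 2 - 2 * s ^+ 3) * a ^+ 2 + 
     (t * f - 2 * s ^+ 3 - s ^+ 4 * (f ^+ 3 + t ^+ 3)) * b ^+ 2).
  by rewrite /c fE; ring.
have ss : s ^+ 2 <= 4^-1 by rewrite expr2; nra.
have s30 : 0 <= s ^+ 3 by apply: exprn_ge0.
have sss : s ^+ 3 <= 8^-1 by rewrite exprS; nra.
have s4 : s ^+ 4 <= s ^+ 3 by rewrite [s ^+ 4]exprS; nra.
have s40 : 0 <= s ^+ 4 by apply: exprn_ge0.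
have c1 : 0 <= 1 - c ^+ 2.
  by rewrite /c fE (_ : _ - _ = 4 * (t * f)); [lra | rewrite fE; ring].
have ft3 : f ^+ 3 + t ^+ 3 <= 1.
  by rewrite -subr_ge0 (_ : _ - _ = 3 * (t * f)); [lra | rewrite fE; ring].
have h4 : s ^+ 4 * (f ^+ 3 + t ^+ 3) <= s ^+ 4 by apply: ler_piMr.
have a2 := sqr_ge0 a; have b2 := sqr_ge0 b; have ab2 := sqr_ge0 (a - c * b).
apply: mulr_ge0; first exact: mulr_ge0.
apply: addr_ge0; first apply: addr_ge0.
- by apply: mulr_ge0; [lra | apply: addr_ge0 => //; apply: mulr_ge0].
- by apply: mulr_ge0 => //; lra.
- by apply: mulr_ge0 => //; lra.
Qed.

(* Bonami's lemma, conditionally on the coordinates outside [s]. *)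
Lemma hypercontractive sg s F x : uniq s ->
    (forall l, [/\ 0 <= sg l, sg l <= 2^-1 & 3 * sg l ^+ 3 <= vr l]) ->
  Es s (fun y => Ts sg s F y ^+ 4) x <= Es s (fun y => F y ^+ 2) x ^+ 2.
Proof.
move=> us hs; elim: s us F => [|l s IH] /=; first by move=> _ F; rewrite -exprM.
move=> /andP[ls us] F; rewrite -T1Ts; set u := Ts sg s F.
have [s0 s2 s3] := hs l.
have v0 : 0 <= vr l by rewrite mulr_ge0.
apply: (@le_trans _ _ (Es s (fun y => Ei l u y ^+ 4 +
   2 * vr l * (Ei l u y ^+ 2 * Di l u y ^+ 2) + vr l ^+ 2 * Di l u y ^+ 4) x)).
  by apply: Es_le => y; apply: T1_four.
have -> : (fun y => Ei l u y ^+ 4 + 2 * vr l * (Ei l u y ^+ 2 * Di l u y ^+ 2) +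
      vr l ^+ 2 * Di l u y ^+ 4) = fun y => vr l ^+ 2 * Di l u y ^+ 4 +
   (2 * vr l * (Ei l u y ^+ 2 * Di l u y ^+ 2) + Ei l u y ^+ 4).
  by apply/funext => y; ring.
have -> : Ei l (fun y => F y ^+ 2) = fun y => vr l * Di l F y ^+ 2 + Ei l F y ^+ 2.
  apply/funext => y; rewrite /Ei /Di.
  have -> : p l false = 1 - p l true by have := p_sum1 l; lra.
  by ring.
rewrite !Es_lin; have hA := IH us (Ei l F); have hB := IH us (Di l F).
move: hA hB; rewrite -EiTs -DiTs// -/u.
set A4 := Es s _ x; set A := Es s _ x; set B4 := Es s _ x; set B := Es s _ x.
move=> hA hB; set C := Es s _ x.
have A0 : 0 <= A by apply: Es_ge0 => y; apply: sqr_ge0.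
have B0 : 0 <= B by apply: Es_ge0 => y; apply: sqr_ge0.
have C0 : 0 <= C by apply: Es_ge0 => y; rewrite mulr_ge0 ?sqr_ge0.
have B40 : 0 <= B4 by apply: Es_ge0 => y; rewrite (exprM _ 2 2) sqr_ge0.
(* The mixed term couples the average and the derivative in coordinate [l]. Cauchy-Schwarz for
   [Es s] reduces it to the two fourth moments bounded by induction. *)
have CAB : C <= A * B.
  rewrite -(@ler_pXn2r _ 2) ?nnegrE ?mulr_ge0//.
  apply: le_trans (_ : A4 * B4 <= _); last by rewrite exprMn; apply: ler_pM => //;
    apply: Es_ge0 => y; rewrite (exprM _ 2 2) sqr_ge0.
  have := @cauchy_schwarz R X (fun G => Es s G x) (fun y => Ei l u y ^+ 2)
     (fun y => Di l u y ^+ 2).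
  have e4 (G : X -> R) : (fun y => G y ^+ 4) = fun y => (G y ^+ 2) ^+ 2.
    by apply/funext => y; rewrite -exprM.
  rewrite /A4 /B4 !e4; apply => [a G H|G G0]; [exact: Es_lin | exact: Es_ge0].
have v20 : 0 <= vr l ^+ 2 by apply: sqr_ge0.
have := ler_wpM2l v20 hB; have := ler_wpM2l v0 CAB.
by rewrite (_ : (vr l * B + A) ^+ 2 = vr l ^+ 2 * B ^+ 2 + 2 * (vr l * (A * B)) + A ^+ 2); [lra | ring].
Qed.

Lemma hypercontractive_Ex sg F :
    (forall l, [/\ 0 <= sg l, sg l <= 2^-1 & 3 * sg l ^+ 3 <= vr l]) ->
  Ex (fun y => Ts sg (enum 'I_n) F y ^+ 4) <= Ex (fun y => F y ^+ 2) ^+ 2.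
Proof.
by move=> hs; rewrite -!(Es_enum _ [ffun=> true]); apply: hypercontractive => //; apply: enum_uniq.
Qed.

Lemma leq_double_exp m : (2 * m <= 2 ^ m)%N.
Proof.
case: m => // m; rewrite expnS leq_mul2l /=.
by elim: m => // m IH; rewrite expnS mul2n -addnn -addn1 leq_add// expn_gt0.
Qed.

(** * A super-Poincare inequality on the dense coordinates *)

Section SuperPoincare.
Variables (D : {set 'I_n}) (k : nat) (r : R).
Local Notation Q := ((2 ^ k)%:R : R).
Local Notation M := (2 ^ (k + k + 2))%N.
Local Notation T sg := (Ts sg (enum 'I_n)).

(** Noise this weak loses at most half of the second moment when the Dirichlet form is below [Q]
    times it. Off [D] the rate 0 costs nothing, as the functions tested do not depend on those
    coordinates. *)
Let sg l : R := if l \in D then 1 - (2 * Q)^-1 else 0.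

Let Q_ge1 : 1 <= Q.
Proof. by rewrite ler1n expn_gt0. Qed.

Let invQ : 0 < (2 * Q)^-1 <= 2^-1.
Proof.
have := Q_ge1 => q1; rewrite invr_gt0 mulr_gt0//=; last by lra.
by rewrite lef_pV2 ?posrE; lra.
Qed.

Let sg01 m l : 0 <= sg l ^+ m <= 1.
Proof.
have := invQ => /andP[q0 q1]; have s : 0 <= sg l <= 1.
  by rewrite /sg; case: ifP => _; lra.
by case/andP: s => s0 s1; rewrite exprn_ge0//= exprn_ile1.
Qed.

(** Each factor satisfies (1 - z)(1 + (m + 1)z) <= 1 + mz. With [m * z = 1] the power is at most
    1/2, which is the use made of it for [rho]. *)
Lemma expr_1B_le (z : R) m : 0 <= z <= 1 -> (1 - z) ^+ m * (1 + m%:R * z) <= 1.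
Proof.
move=> /andP[z0 z1]; elim: m => [|m IH]; first by rewrite expr0 mul0r addr0 mul1r.
have m0 : (0 : R) <= m%:R by [].
have h0 : 0 <= (1 - z) ^+ m by rewrite exprn_ge0// subr_ge0.
apply: le_trans IH; rewrite exprS -mulrA mulrCA; apply: ler_wpM2l => //.
by rewrite -natr1 -subr_ge0 (_ : _ - _ = m%:R * z ^+ 2 + z ^+ 2);
  [rewrite addr_ge0 ?mulr_ge0 ?sqr_ge0 | ring].
Qed.

(* Log-convexity of the spectral measure, along dyadic powers of the noise. *)
Let dyadic d (j : nat) : Ex (fun x => d x ^+ 2) <= 2 * Ex (fun x => d x * T sg d x) ->
  Ex (fun x => d x ^+ 2) <=
  2 ^+ (2 ^ j)%N * Ex (fun x => d x * T (fun l => sg l ^+ (2 ^ j)%N) d x).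
Proof.
move=> h; set e2 := Ex (fun x => d x ^+ 2).
have e20 : 0 <= e2 by apply: E_ge0 => x; [exact: wt_ge0 | exact: sqr_ge0].
elim: j => [|j IH]; first exact: h.
set a := Ex (fun x => _ * Ts _ _ _ x) in IH; set a' := Ex (fun x => _ * Ts _ _ _ x).
have aa : a ^+ 2 <= e2 * a'.
  have -> : a' = Ex (fun x => T (fun l => sg l ^+ (2 ^ j)%N) d x ^+ 2).
    rewrite /a' (_ : (fun l => sg l ^+ (2 ^ j.+1)%N) = fun l => sg l ^+ (2 ^ j)%N * sg l ^+ (2 ^ j)%N).
      by rewrite -Ts_M Ts_adj; congr E; apply/funext => x; rewrite expr2.
    by apply/funext => l; rewrite -exprD addnn -mul2n -expnS.
  by apply: cauchy_schwarz => [c F G|F F0]; [exact: E_lin | apply: E_ge0 => // x; exact: wt_ge0].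
have [e0|e_gt0] := leP e2 0.
  have -> : e2 = 0 by apply/eqP; rewrite eq_le e0.
  have a'E : a' = Ex (fun x => T (fun l => sg l ^+ (2 ^ j)%N) d x ^+ 2).
    rewrite /a' (_ : (fun l => sg l ^+ (2 ^ j.+1)%N) = fun l => sg l ^+ (2 ^ j)%N * sg l ^+ (2 ^ j)%N).
      by rewrite -Ts_M Ts_adj; congr E; apply/funext => x; rewrite expr2.
    by apply/funext => l; rewrite -exprD addnn -mul2n -expnS.
  rewrite mulr_ge0 ?exprn_ge0// a'E; apply: E_ge0 => x; [exact: wt_ge0 | exact: sqr_ge0].
have c0 : (0 : R) < 2 ^+ (2 ^ j)%N by apply: exprn_gt0.
have h2 : e2 ^+ 2 <= (2 ^+ (2 ^ j)%N * a) ^+ 2 by rewrite ler_pXn2r ?nnegrE//; apply: le_trans IH.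
rewrite -(@ler_pM2l _ e2)// -expr2; apply: le_trans h2 _.
rewrite exprMn expnSr exprM [leRHS]mulrCA.
by apply: ler_wpM2l => //; apply: sqr_ge0.
Qed.

(* If the Dirichlet form of [d] is at most [Q] times its second moment, then
   noise of rate about [1 / Q] keeps half of the second moment, so noise strong
   enough for Bonami's lemma keeps a fraction [2 ^- M] of it. *)
Lemma super_poincare d : (0 < r) -> r <= Q ->
    (forall l, l \in D -> r^-1 <= vr l) ->
    (forall l, l \notin D -> inv l d) ->
  Ex (fun x => d x ^+ 2) <=
  Q^-1 * (\sum_(l in D) Ex (fun x => (d x - Ei l d x) ^+ 2)) +
  4 ^+ M * Ex (fun x => `|d x|) ^+ 2.
Proof.
move=> r0 rQ vD dD; set e2 := Ex (fun x => d x ^+ 2); set S := \sum_(l in D) _.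
set e1 := Ex (fun x => `|d x|).
have wt0 := wt_ge0.
have S0 : 0 <= S by apply: sumr_ge0 => l _; apply: E_ge0 => // x; exact: sqr_ge0.
have e20 : 0 <= e2 by apply: E_ge0 => // x; exact: sqr_ge0.
have e10 : 0 <= e1 by apply: E_ge0.
have M0 : (0 : R) <= 4 ^+ M by apply: exprn_ge0.
have q1 := Q_ge1.
have [|SQ] := leP (Q * e2) S.
  by move=> h; apply: ler_wpDr; [rewrite mulr_ge0 ?sqr_ge0 | rewrite ler_pdivlMl; lra].
apply: ler_wpDl; first by rewrite mulr_ge0// invr_ge0; lra.
have loss := noise_loss (enum 'I_n) d (sg01 1).
have half : e2 <= 2 * Ex (fun x => d x * T sg d x).
  suff : \sum_(l <- enum 'I_n) (1 - sg l ^+ 1) * Ex (fun x => (d x - Ei l d x) ^+ 2) <= e2 / 2.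
    by move=> h; have := le_trans loss h; rewrite -/e2; lra.
  rewrite big_enum /= (eq_bigr (fun l => (2 * Q)^-1 * if l \in D then
      Ex (fun x => (d x - Ei l d x) ^+ 2) else 0)) => [|l _].
    by rewrite -mulr_sumr -big_mkcond /= -/S ler_pdivrMl; lra.
  rewrite expr1 /sg; case: ifPn => [_|/dD /Ei_inv ->]; first by congr (_ * _); ring.
  rewrite subr0 mul1r mulr0 /E big1// => x _.
  by rewrite subrr expr0n mulr0.
have := dyadic (k + k + 2) half.
rewrite -/e2; set a := Ex (fun x => d x * Ts _ _ _ x) => ha; pose rho l := sg l ^+ (2 ^ (k + k + 1))%N.
have rhoE : (fun l => sg l ^+ (2 ^ (k + k + 2))%N) = fun l => rho l * rho l.
  by apply/funext => l; rewrite /rho -expr2 -exprM -expnSr addn1 addn2.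
set w := T rho d; set v := T rho w.
have aE : a = Ex (fun x => w x ^+ 2).
  by rewrite /a rhoE -Ts_M Ts_adj; congr E; apply/funext => x; rewrite expr2.
have aE' : a = Ex (fun x => d x * v x) by rewrite /a rhoE -Ts_M.
have rho_ok l : [/\ 0 <= rho l, rho l <= 2^-1 & 3 * rho l ^+ 3 <= vr l].
  have r00 : 0 <= rho l by case/andP: (sg01 (2 ^ (k + k + 1))%N l).
  have [lD|lD] := boolP (l \in D); last first.
    rewrite /rho /sg (negPf lD) expr0n /= expn_eq0 /= expr0n /= mulr0.
    by split; rewrite ?invr_ge0// mulr_ge0.
  (* The exponent of [rho] is 2Q times Q, so [rho l <= 2^-Q <= 1/(2Q)]. This meets Bonami's
     condition because the variance of a bit in [D] is at least 1/r >= 1/Q. *)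
  suff rhoQ : rho l <= (2 * Q)^-1.
    have /andP[i0 i1] := invQ.
    split=> //; first exact: le_trans rhoQ i1.
    apply: le_trans (vD l lD).
    have : Q^-1 <= r^-1 by rewrite lef_pV2 ?posrE//; lra.
    apply: le_trans; rewrite (_ : Q^-1 = 2 * (2 * Q)^-1); last by field; lra.
    have h2 : rho l ^+ 2 <= 4^-1 by rewrite expr2; nra.
    have h20 : 0 <= rho l ^+ 2 by apply: sqr_ge0.
    rewrite exprSr; have : rho l ^+ 2 * rho l <= 4^-1 * rho l by apply: ler_wpM2r.
    by lra.
  rewrite /rho /sg lD.
  have -> : (2 ^ (k + k + 1) = (2 * 2 ^ k) * 2 ^ k)%N by rewrite addn1 -addSn expnD expnS.
  rewrite exprM; have /andP[i0 i1] := invQ.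
  have h : (1 - (2 * Q)^-1) ^+ (2 * 2 ^ k)%N <= 2^-1.
    have := @expr_1B_le (2 * Q)^-1 (2 * 2 ^ k)%N.
    rewrite natrM divff; last by rewrite mulf_neq0//; lra.
    by move=> /(_ _); rewrite -(@ler_pdivlMr _ 2)//; lra.
  apply: (@le_trans _ _ (2^-1 ^+ (2 ^ k)%N)).
    apply: lerXn2r => //; rewrite nnegrE ?invr_ge0//.
    by apply: exprn_ge0; lra.
  rewrite exprVn lef_pV2 ?posrE ?exprn_gt0//; last by lra.
  by rewrite -natrX -natrM ler_nat leq_double_exp.
have v4 : Ex (fun x => v x ^+ 4) <= a ^+ 2 by rewrite aE; apply: hypercontractive_Ex.
set b := Ex (fun x => `|d x| * v x ^+ 2).
(* Cauchy-Schwarz under the weight [|d|], with [d] written as its absolute value times its sign.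
   Together with [bb] it gives [a ^+ 2 <= e1 ^+ 2 * e2]. *)
have ab : a ^+ 2 <= e1 * b.
  have := @cauchy_schwarz R X (fun F => Ex (fun x => `|d x| * F x))
    (fun x => Num.sg (d x)) v.
  have -> : (fun x => `|d x| * (Num.sg (d x) * v x)) = fun x => d x * v x.
    by apply/funext => x; rewrite mulrA [_ * Num.sg _]mulrC -numEsg.
  have -> : (fun x => `|d x| * Num.sg (d x) ^+ 2) = fun x => `|d x|.
    apply/funext => x; rewrite sqr_sg.
    by case: eqVneq => [->|_]; rewrite ?normr0 ?mul0r// mulr1.
  rewrite -aE'; apply => [c F G|F F0].
    by rewrite -E_lin; congr E; apply/funext => x; ring.
  by apply: E_ge0 => // x; rewrite mulr_ge0.
have b0 : 0 <= b by apply: E_ge0 => // x; rewrite mulr_ge0// sqr_ge0.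
have a0 : 0 <= a by rewrite aE; apply: E_ge0 => // x; apply: sqr_ge0.
have bb : b ^+ 2 <= e2 * a ^+ 2.
  apply: le_trans (_ : e2 * Ex (fun x => v x ^+ 4) <= _); last exact: ler_wpM2l.
  have -> : e2 = Ex (fun x => `|d x| ^+ 2).
    by congr E; apply/funext => x; rewrite real_normK// num_real.
  have -> : (fun x => v x ^+ 4) = fun x => (v x ^+ 2) ^+ 2.
    by apply/funext => x; rewrite -exprM.
  by apply: cauchy_schwarz => [c F G|F F0]; [exact: E_lin | apply: E_ge0].
have [e2le|e2gt] := leP e2 0; first by apply: le_trans e2le _; rewrite mulr_ge0 ?sqr_ge0.
have a_gt0 : 0 < a.
  by rewrite lt_neqAle a0 andbT eq_sym; apply: contraTneq ha => ->; rewrite mulr0 -ltNge.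
have a2 : a ^+ 2 <= e1 ^+ 2 * e2.
  rewrite -(@ler_pM2r _ (a ^+ 2)) ?exprn_gt0// -[leLHS]expr2 -[leRHS]mulrA.
  apply: (@le_trans _ _ ((e1 * b) ^+ 2)).
    by rewrite ler_pXn2r ?nnegrE ?sqr_ge0 ?mulr_ge0.
  by rewrite exprMn; apply: ler_wpM2l => //; apply: sqr_ge0.
rewrite -(@ler_pM2r _ e2)// -[leLHS]expr2 -[leRHS]mulrA.
apply: (@le_trans _ _ ((2 ^+ M * a) ^+ 2)).
  by rewrite ler_pXn2r ?nnegrE ?mulr_ge0 ?exprn_ge0.
have -> : 4 ^+ M = (2 ^+ M) ^+ 2 :> R by rewrite -exprM mulnC exprM; congr (_ ^+ _); rewrite -natrX.
by rewrite exprMn; apply: ler_wpM2l => //; apply: sqr_ge0.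
Qed.

End SuperPoincare.

(** * Variance as a sum of martingale increments *)

Fixpoint energy s F : R :=
  if s is l :: s' then Ex (fun x => (F x - Ei l F x) ^+ 2) + energy s' (Ei l F) else 0.

Lemma Ex_sqr_Ei i F : Ex (fun x => F x ^+ 2) =
  Ex (fun x => (F x - Ei i F x) ^+ 2) + Ex (fun x => Ei i F x ^+ 2).
Proof.
have h : Ex (fun x => Ei i F x * (F x - Ei i F x)) = 0.
  rewrite -(Ex_Ei i) EiM; last exact: inv_Ei.
  by rewrite EiB EiK /E big1// => x _; rewrite subrr !mulr0.
rewrite -ED -[RHS]addr0 -(mulr0 2) -h -EZ -ED; congr E; apply/funext => x; ring.
Qed.

Lemma energyE s F : Ex (fun x => F x ^+ 2) = energy s F + Ex (fun x => Es s F x ^+ 2).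
Proof. by elim: s F => [|l s IH] F /=; rewrite ?add0r// -addrA -IH -Ex_sqr_Ei. Qed.

Lemma energy_cat s1 s2 F : energy (s1 ++ s2) F = energy s1 F + energy s2 (Es s1 F).
Proof. by elim: s1 F => [|l s IH] F /=; rewrite ?add0r// IH addrA. Qed.

Lemma Ei_sqr_le i F : Ex (fun x => Ei i F x ^+ 2) <= Ex (fun x => F x ^+ 2).
Proof. by rewrite (Ex_sqr_Ei i F) lerDr E_ge0// => x; [exact: wt_ge0 | exact: sqr_ge0]. Qed.

Lemma EiBC i j F : (fun x => Ei i F x - Ei j (Ei i F) x) = Ei i (fun x => F x - Ei j F x).
Proof. by rewrite EiB EiC. Qed.

Lemma Ei_dev_le i j F : Ex (fun x => (Ei i F x - Ei j (Ei i F) x) ^+ 2) <=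
  Ex (fun x => (F x - Ei j F x) ^+ 2).
Proof.
by have := Ei_sqr_le i (fun x => F x - Ei j F x); rewrite -EiBC.
Qed.

(** Averaging out other coordinates commutes with [Ei j] and contracts second moments, so it cannot
    increase the influence of [j]. *)
Lemma Es_dev_le s j F : Ex (fun x => (Es s F x - Ei j (Es s F) x) ^+ 2) <=
  Ex (fun x => (F x - Ei j F x) ^+ 2).
Proof. by elim: s F => //= l s IH F; apply: le_trans (IH _) (Ei_dev_le _ _ _). Qed.

Lemma Ei_abs_le i j F : Ex (fun x => `|Ei i F x - Ei j (Ei i F) x|) <=
  Ex (fun x => `|F x - Ei j F x|).
Proof.
rewrite -(Ex_Ei i (fun x => `|F x - _|)); apply: E_le => [|x]; first exact: wt_ge0.
by rewrite -[X in `|X|]/((fun x => Ei i F x - Ei j (Ei i F) x) x) EiBC; apply: Ei_norm.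
Qed.

Lemma Es_abs_le s j F : Ex (fun x => `|Es s F x - Ei j (Es s F) x|) <=
  Ex (fun x => `|F x - Ei j F x|).
Proof. by elim: s F => //= l s IH F; apply: le_trans (IH _) (Ei_abs_le _ _ _). Qed.

Lemma energy_le s F :
  energy s F <= \sum_(l <- s) Ex (fun x => (F x - Ei l F x) ^+ 2).
Proof.
elim: s F => [|l s IH] F; rewrite ?big_nil//= big_cons lerD2l.
by apply: le_trans (IH _) _; apply: ler_sum => j _; apply: Ei_dev_le.
Qed.

(* Martingale increments are tested against the super-Poincare inequality, and
   their Dirichlet forms add up to at most that of [F] (Falik-Samorodnitsky). *)
Lemma energy_dense (D : {set 'I_n}) k r s F : 0 < r -> r <= (2 ^ k)%:R ->
    (forall l, l \in D -> r^-1 <= vr l) ->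
    (forall l, l \notin D -> inv l F) ->
  energy s F <=
  (2 ^ k)%:R^-1 * (\sum_(l in D) Ex (fun x => (F x - Ei l F x) ^+ 2)) +
  4 ^+ (2 ^ (k + k + 2))%N * \sum_(l <- s) Ex (fun x => `|F x - Ei l F x|) ^+ 2.
Proof.
move=> r0 rQ vD FD; set c := 4 ^+ _.
have c0 : 0 <= c by apply: exprn_ge0.
have Q0 : 0 <= (2 ^ k)%:R^-1 :> R by rewrite invr_ge0.
(* The induction keeps [energy s (F - Ei l F)] instead of the Dirichlet form, since these energies
   then split increment by increment; [energyE] bounds them by second moments at the end. *)
suff h : energy s F <= (2 ^ k)%:R^-1 * (\sum_(l in D) energy s (fun x => F x - Ei l F x)) +
  c * \sum_(l <- s) Ex (fun x => `|F x - Ei l F x|) ^+ 2.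
  apply: le_trans h _; rewrite lerD2r; apply: ler_wpM2l => //.
  apply: ler_sum => l _; rewrite [leRHS](energyE s) lerDl.
  by apply: E_ge0 => x; [exact: wt_ge0 | exact: sqr_ge0].
elim: s F FD => [|i s IH] F FD /=.
  by rewrite big_nil mulr0 addr0 mulr_ge0// sumr_ge0.
rewrite big_cons big_split /=.
have dD l : l \notin D -> inv l (fun x => F x - Ei i F x).
  by move=> /FD h x b; rewrite h (inv_EiC i h).
have h1 := super_poincare r0 rQ vD dD.
have h2 := IH (Ei i F) (fun l lD => inv_EiC i (FD l lD)).
have h3 : \sum_(l <- s) Ex (fun x => `|Ei i F x - Ei l (Ei i F) x|) ^+ 2 <=
    \sum_(l <- s) Ex (fun x => `|F x - Ei l F x|) ^+ 2.
  apply: ler_sum => l _; rewrite ler_pXn2r ?nnegrE ?Ei_abs_le//;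
    by apply: E_ge0 => // x; exact: wt_ge0.
have h4 := ler_wpM2l c0 h3.
have e1 : \sum_(l in D) Ex (fun x => ((F x - Ei i F x) - Ei l (fun x => F x - Ei i F x) x) ^+ 2)
  = \sum_(l in D) Ex (fun x => ((F x - Ei l F x) - Ei i (fun x => F x - Ei l F x) x) ^+ 2).
  apply: eq_bigr => l _; congr E; apply/funext => x.
  by rewrite !EiB (EiC l i); congr (_ ^+ 2); ring.
have e2 : \sum_(l in D) energy s (Ei i (fun x => F x - Ei l F x)) =
   \sum_(l in D) energy s (fun x => Ei i F x - Ei l (Ei i F) x).
  by apply: eq_bigr => l _; rewrite EiBC.
move: h1; rewrite -/c e1 e2 => h1.
move: h1 h2 h4; set a := Ex _; set b := energy _ _; set S1 := \sum_(l in D) _.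
set S2 := \sum_(l in D) _; set S3 := \sum_(l <- s) _; set S4 := \sum_(l <- s) _.
by rewrite !mulrDr; set e := Ex _ ^+ 2; lra.
Qed.

(** Coordinates outside [D] are averaged out first and charged their Efron-Stein terms. What remains
    depends on [D] only, so [energy_dense] applies to it. *)
Lemma variance_le (D : {set 'I_n}) k r F : 0 < r -> r <= (2 ^ k)%:R ->
    (forall l, l \in D -> r^-1 <= vr l) ->
  Ex (fun x => F x ^+ 2) - Ex F ^+ 2 <=
  \sum_(l in ~: D) Ex (fun x => (F x - Ei l F x) ^+ 2) +
  (2 ^ k)%:R^-1 * (\sum_(l in D) Ex (fun x => (F x - Ei l F x) ^+ 2)) +
  4 ^+ (2 ^ (k + k + 2))%N * \sum_(l in D) Ex (fun x => `|F x - Ei l F x|) ^+ 2.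
Proof.
move=> r0 rQ vD; set s1 := enum (~: D); set s2 := enum D.
have FD l : l \notin D -> inv l (Es s1 F).
  by move=> lD; apply: Es_invs; rewrite mem_enum inE.
have inv_s l : inv l (Es (s1 ++ s2) F).
  by apply: Es_invs; rewrite mem_cat !mem_enum inE orNb.
have EsE : Es (s1 ++ s2) F = fun=> Ex F.
  apply/funext => x; rewrite -(Ex_Es (s1 ++ s2)) -[LHS](E_cst _ wt_dist).
  by congr E; apply/funext => y; apply: inv_all.
rewrite (energyE (s1 ++ s2)) EsE E_cst ?addrK; last exact: wt_dist.
rewrite energy_cat -addrA; apply: lerD.
  by apply: le_trans (energy_le _ _) _; rewrite big_enum.
apply: le_trans (energy_dense s2 r0 rQ vD FD) _; apply: lerD.
  apply: ler_wpM2l; first by rewrite invr_ge0.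
  by apply: ler_sum => l _; apply: Es_dev_le.
apply: ler_wpM2l; first exact: exprn_ge0.
rewrite big_enum /=; apply: ler_sum => l _; rewrite ler_pXn2r ?nnegrE ?Es_abs_le//;
  by apply: E_ge0 => // x; exact: wt_ge0.
Qed.

End ProductSpace.

(** * Random sets of players *)

Section Push.
Variables (R : realFieldType) (T U : finType) (w : T -> R) (f : T -> U).

Definition push : U -> R := fun u => \sum_t w t * (f t == u)%:R.

Lemma E_push (H : U -> R) : E push H = E w (fun t => H (f t)).
Proof.
rewrite /E /push; under eq_bigr do rewrite mulr_suml.
rewrite exchange_big; apply: eq_bigr => t _ /=.
rewrite (bigD1 (f t))//= eqxx mulr1 big1 ?addr0// => u /negPf.
by rewrite eq_sym => ->; rewrite mulr0 mul0r.
Qed.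

Lemma dist_push : dist w -> dist push.
Proof.
move=> dw; split; first by move=> u; apply: sumr_ge0 => t _; rewrite mulr_ge0//; case: dw.
have := E_push (fun=> 1); rewrite (E_cst 1 dw) /E => <-.
by apply: eq_bigr => u _; rewrite mulr1.
Qed.

End Push.

Section RandomSets.
Variables (R : realFieldType) (n : nat).
Local Notation S := {set 'I_n}.
Implicit Types (v w s : S -> R) (H : S -> R).

Definition conv v w : S -> R :=
  push (fun z : S * S => v z.1 * w z.2) (fun z => z.1 :|: z.2).

Lemma E_conv v w H : E (conv v w) H = E v (fun U => E w (fun V => H (U :|: V))).
Proof.
rewrite E_push /E -(pair_bigA _ (fun U V => v U * w V * H (U :|: V))) /=.
by apply: eq_bigr => U _; rewrite mulr_sumr; apply: eq_bigr => V _; rewrite mulrA.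
Qed.

Lemma dist_conv v w : dist v -> dist w -> dist (conv v w).
Proof.
move=> [v0 v1] [w0 w1]; apply: dist_push; split=> [[U V]|]; first by rewrite mulr_ge0.
rewrite -(pair_bigA _ (fun U V => v U * w V)) /= -[RHS]v1.
by apply: eq_bigr => U _; rewrite -mulr_sumr w1 mulr1.
Qed.

Fixpoint cpow s k : S -> R :=
  if k is k'.+1 then conv s (cpow s k') else fun U => (U == set0)%:R.

Lemma E_cpow0 s H : E (cpow s 0) H = H set0.
Proof.
rewrite /E (bigD1 set0)//= eqxx mul1r big1 ?addr0// => U /negPf ->.
by rewrite mul0r.
Qed.

Lemma dist_cpow0 s : dist (cpow s 0).
Proof.
split=> [U|]; first by [].
by have := E_cpow0 s (fun=> 1); rewrite /E; under eq_bigr do rewrite mulr1.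
Qed.

Lemma dist_cpow s k : dist s -> dist (cpow s k).
Proof. by move=> ds; elim: k => [|k IH]; [exact: dist_cpow0 | exact: dist_conv]. Qed.

Lemma E_cpowD s j k H :
  E (cpow s (j + k)) H = E (cpow s j) (fun U => E (cpow s k) (fun V => H (U :|: V))).
Proof.
elim: j H => [|j IH] H; first by rewrite add0n E_cpow0; congr E; apply/funext => V; rewrite set0U.
rewrite addSn /= !E_conv; congr E; apply/funext => U.
by rewrite IH; congr E; apply/funext => V; congr E; apply/funext => W; rewrite setUA.
Qed.

Lemma E_cpowSr s k H :
  E (cpow s k.+1) H = E (cpow s k) (fun U => E s (fun V => H (U :|: V))).
Proof.
rewrite /= E_conv E_swap; congr E; apply/funext => U; congr E; apply/funext => V.
by rewrite setUC.
Qed.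

Lemma cpow_mono s j k H : dist s -> (j <= k)%N ->
    (forall U V : S, U \subset V -> H U <= H V) ->
  E (cpow s j) H <= E (cpow s k) H.
Proof.
move=> ds jk Hm; rewrite -(subnKC jk) E_cpowD; apply: E_le => [|U]; first by case: (dist_cpow j ds).
rewrite -[leLHS](E_cst _ (dist_cpow (k - j) ds)).
by apply: E_le => [|V]; [case: (dist_cpow (k - j) ds) | apply/Hm/subsetUl].
Qed.

(** The union of j independent sets, with j uniform in t <= j < 2t. Averaging over j makes the
    effect of one more set telescope, see [E_blk_step]. *)
Definition blk s t : S -> R := fun U => t%:R^-1 * \sum_(k < t) cpow s (t + k) U.

Lemma E_blk s t H : E (blk s t) H = t%:R^-1 * \sum_(k < t) E (cpow s (t + k)) H.
Proof.
rewrite /E /blk; under eq_bigr do rewrite -mulrA mulr_suml.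
by rewrite -mulr_sumr exchange_big.
Qed.

Lemma blk_le s t H (d : R) : (0 < t)%N ->
    (forall k, (t <= k < t + t)%N -> E (cpow s k) H <= d) ->
  E (blk s t) H <= d.
Proof.
move=> t0 h; rewrite E_blk ler_pdivrMl ?ltr0n//.
have -> : t%:R * d = \sum_(k < t) d by rewrite sumr_const card_ord mulr_natl.
by apply: ler_sum => k _; apply: h; rewrite leq_addr ltn_add2l ltn_ord.
Qed.

Lemma blk_ge s t H (c : R) : (0 < t)%N ->
    (forall k, (t <= k < t + t)%N -> c <= E (cpow s k) H) ->
  c <= E (blk s t) H.
Proof.
move=> t0 h; rewrite -lerN2 -mulN1r -EZ; apply: blk_le => // k /h.
by rewrite EZ mulN1r lerN2.
Qed.

Lemma blk2_le s t (H : S -> S -> R) (d : R) : (0 < t)%N ->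
    (forall j k, (t <= j < t + t)%N -> (t <= k < t + t)%N ->
      E (cpow s j) (fun U => E (cpow s k) (fun V => H U V)) <= d) ->
  E (blk s t) (fun U => E (blk s t) (fun V => H U V)) <= d.
Proof.
move=> t0 h; apply: blk_le => // j hj; rewrite E_swap; apply: blk_le => // k hk.
by rewrite E_swap; apply: h.
Qed.

Lemma dist_blk s t : (0 < t)%N -> dist s -> dist (blk s t).
Proof.
move=> t0 ds; split=> [U|].
  by rewrite mulr_ge0 ?invr_ge0// sumr_ge0// => k _; case: (dist_cpow (t + k) ds).
have : E (blk s t) (fun=> 1) <= 1 /\ 1 <= E (blk s t) (fun=> 1).
  by split; [apply: blk_le | apply: blk_ge] => // k _; rewrite E_cst//; apply: dist_cpow.
rewrite /E; under eq_bigr do rewrite mulr1; move=> [h1 h2].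
by apply/eqP; rewrite eq_le h1.
Qed.

Lemma E_blk_step s t H :
  E (blk s t) (fun U => E s (fun V => H (U :|: V)) - H U) =
  t%:R^-1 * (E (cpow s (t + t)) H - E (cpow s t) H).
Proof.
rewrite E_blk; congr (_ * _).
under eq_bigr => k _ do rewrite EB -E_cpowSr -addnS.
rewrite -(big_mkord xpredT (fun k => E (cpow s (t + k.+1)) H - E (cpow s (t + k)) H)).
by rewrite telescope_sumr// addn0.
Qed.

(** Two blocks together use at most 4t sets and the second alone at least t, so monotonicity
    sandwiches both. Hence the ratio 4 between consecutive scales later. *)
Lemma blk_inc s t H : (0 < t)%N -> dist s ->
    (forall U V : S, U \subset V -> H U <= H V) ->
  E (blk s t) (fun U => E (blk s t) (fun V => H (U :|: V) - H V)) <=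
  E (cpow s (4 * t)) H - E (cpow s t) H.
Proof.
move=> t0 ds Hm; apply: blk2_le => // j k /andP[tj jt] /andP[tk kt].
under [X in E _ X <= _]funext do rewrite EB.
rewrite EB -E_cpowD E_cst; last exact: dist_cpow.
by apply: lerB; apply: cpow_mono => //; lia.
Qed.

Definition supp w m := forall U, w U != 0 -> (#|U| <= m)%N.

Lemma supp_push (T : finType) (w : T -> R) (f : T -> S) m :
  (forall t, (#|f t| <= m)%N) -> supp (push w f) m.
Proof.
move=> fm U; apply: contraR => Um; rewrite /push big1// => t _.
by case: eqP => [fU|]; rewrite ?mulr0//; rewrite -fU fm in Um.
Qed.

Lemma supp_conv v w j k : supp v j -> supp w k -> supp (conv v w) (j + k).
Proof.
move=> hv hw U; apply: contraR => Um; rewrite /conv /push big1// => -[V W] _ /=.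
case: eqP => [VWU|]; rewrite ?mulr0// mulr1.
have [v0|/hv Vj] := eqVneq (v V) 0; first by rewrite v0 mul0r.
have [w0|/hw Wk] := eqVneq (w W) 0; first by rewrite w0 mulr0.
case/negP: Um; rewrite -VWU (leq_trans _ (leq_add Vj Wk))//.
by rewrite cardsU leq_subr.
Qed.

Lemma supp_cpow s m k : supp s m -> supp (cpow s k) (k * m).
Proof.
move=> hs; elim: k => [|k IH]; last by rewrite mulSn; apply: supp_conv.
by move=> U /=; have [->|_] := eqVneq U set0; rewrite ?cards0 ?eqxx.
Qed.

Definition unif1 : S -> R := push (fun _ : 'I_n => n%:R^-1) (fun i => [set i]).

Hypothesis n_gt0 : (0 < n)%N.

Lemma dist_unif1 : dist unif1.
Proof.
apply: dist_push; split=> [i|]; first by rewrite invr_ge0.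
by rewrite sumr_const card_ord -[LHS]mulr_natl divff// pnatr_eq0 -lt0n.
Qed.

(** The sum over players is n times the expected gain from one more uniform player, which the block
    telescopes to 1/b times a difference of two values in [0, 1]. *)
Lemma unif1_gain b H : (0 < b)%N -> (forall U, 0 <= H U <= 1) ->
  E (blk unif1 b) (fun U => \sum_i (H (i |: U) - H U)) <= n%:R / b%:R.
Proof.
move=> b0 H01; have nR : (0 : R) < n%:R by rewrite ltr0n.
have -> : (fun U => \sum_i (H (i |: U) - H U)) =
    fun U => n%:R * (E unif1 (fun V => H (U :|: V)) - H U).
  apply/funext => U; rewrite -{2}(E_cst (H U) dist_unif1) -EB E_push /E mulr_sumr.
  apply: eq_bigr => i _; rewrite mulrA divff ?mul1r; last by lra.
  by rewrite setUC.
rewrite EZ E_blk_step mulrA; apply: ler_piMr; first by rewrite divr_ge0.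
have hle k : 0 <= E (cpow unif1 k) H <= 1.
  have dk := dist_cpow k dist_unif1.
  rewrite E_ge0 ?E_lec//; first by move=> U; case/andP: (H01 U).
    by case: dk.
  by move=> U; case/andP: (H01 U).
by have := hle (b + b)%N; have := hle b; lra.
Qed.

End RandomSets.

Lemma E_mul (R : realFieldType) (S T : finType) (v : S -> R) (w : T -> R) F G :
  E v F * E w G = E v (fun s => E w (fun t => F s * G t)).
Proof.
rewrite /E mulr_suml; apply: eq_bigr => s _.
by rewrite !mulr_sumr; apply: eq_bigr => t _; ring.
Qed.

Lemma E_cB (R : realFieldType) (T : finType) (w : T -> R) F c : dist w ->
  E w (fun t => c - F t) = c - E w F.
Proof. by move=> dw; rewrite EB E_cst. Qed.

(** * One round *)

Section SingleRound.
Variables (R : realFieldType) (n : nat) (p : 'I_n -> bool -> R).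
Hypothesis p_ge0 : forall i b, 0 <= p i b.
Hypothesis p_sum1 : forall i, p i true + p i false = 1.
Hypothesis n_gt0 : (0 < n)%N.
Local Notation X := (bits 'I_n).
Local Notation S := {set 'I_n}.
Local Notation Ex := (E (wt p)).
Variable A : pred X.
Implicit Types (x y : X) (B Z T U : S) (i : 'I_n).

Definition reach B x : bool := [exists y, A y && [forall i, (i \notin B) ==> (y i == x i)]].

Lemma reachP B x :
  reflect (exists2 y, A y & forall i, i \notin B -> y i = x i) (reach B x).
Proof.
apply: (iffP existsP) => [[y /andP[Ay /forallP h]]|[y Ay h]].
  by exists y => // i iB; apply/eqP; have := h i; rewrite iB.
by exists y; rewrite Ay; apply/forallP => i; apply/implyP => iB; rewrite h.
Qed.

Lemma reach_mono B B' x : B \subset B' -> reach B x -> reach B' x.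
Proof.
move=> /subsetP BB /reachP[y Ay h]; apply/reachP; exists y => // i iB.
by apply: h; apply: contra iB; apply: BB.
Qed.

(** A coalition containing [i] sets bit [i] itself, so whatever a change of that bit achieves,
    adding [i] achieves too. This is how influences are charged to the growth of the coalition. *)
Lemma reach_upd B x i b : reach B (upd x i b) -> reach (i |: B) x.
Proof.
move=> /reachP[y Ay h]; apply/reachP; exists y => // j.
by rewrite in_setU1 negb_or => /andP[/negPf ji /h ->]; rewrite ffunE ji.
Qed.

Definition g B x : R := (reach B x)%:R.

Lemma g_ge0 B x : 0 <= g B x. Proof. by []. Qed.

Lemma g_le1 B x : g B x <= 1. Proof. by rewrite /g; case: reach. Qed.

Lemma g_mono B B' x : B \subset B' -> g B x <= g B' x.
Proof.
move=> BB; have := @reach_mono B B' x BB; rewrite /g.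
by do 2!case: reach => //; move=> /(_ isT).
Qed.

Lemma g_upd B x i b : g B (upd x i b) <= g (i |: B) x.
Proof. by have := @reach_upd B x i b; rewrite /g; do 2!case: reach => //; move=> /(_ isT). Qed.

Lemma g_bool B x : (g B x == 0) || (g B x == 1).
Proof. by rewrite /g; case: reach; rewrite eqxx ?orbT. Qed.

Variable Th : nat.
Hypothesis Th_gt1 : (1 < Th)%N.

Let Th0 : 0 < Th%:R :> R. Proof. by rewrite ltr0n ltnW. Qed.
Let n0 : 0 < n%:R :> R. Proof. by rewrite ltr0n. Qed.

Definition sparse : S := [set i | (p i true <= Th%:R^-1) || (p i false <= Th%:R^-1)].

Definition rare i : bool := p i true <= Th%:R^-1.

Lemma rare_le i : i \in sparse -> p i (rare i) <= Th%:R^-1.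
Proof. by rewrite inE /rare; case: (leP (p i true)) => // h /orP[]//; rewrite leNgt h. Qed.

Definition raise x T : X := [ffun i => if i \in T :&: sparse then rare i else x i].

Lemma raise0 x : raise x set0 = x.
Proof. by apply/ffunP => i; rewrite ffunE set0I inE. Qed.

Lemma raiseU x T U : raise x (T :|: U) = raise (raise x T) U.
Proof. by apply/ffunP => i; rewrite !ffunE !inE; case: (i \in T); case: (i \in U) => //=; case: ifP. Qed.

Lemma raise1 x i : i \in sparse -> raise x [set i] = upd x i (rare i).
Proof.
move=> si; apply/ffunP => j; rewrite !ffunE !inE.
case: (eqVneq j i) => // ->.
by move: si; rewrite inE => ->.
Qed.

Lemma raise_upd_sparse x i T : i \in sparse ->
  raise (upd x i (rare i)) T = raise x (T :|: [set i]).
Proof. by move=> si; rewrite -raise1// -raiseU setUC. Qed.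

Lemma raise_upd_dense x i b T : i \notin sparse -> raise (upd x i b) T = upd (raise x T) i b.
Proof.
move=> si; apply/ffunP => j; rewrite !ffunE inE.
by case: (eqVneq j i) => [->|//]; rewrite (negPf si) andbF.
Qed.

(** Proportional to the probability of the rare value, so that steps of [sT] bound the Efron-Stein
    terms of sparse coordinates up to the factor n/Th. The scaling keeps [om i] at most 1/n on
    sparse coordinates, so that a random raise is dominated by the addition of a uniform player. *)
Definition om i : R := p i (rare i) * (Th%:R / n%:R).

Lemma om_ge0 i : 0 <= om i.
Proof. by rewrite mulr_ge0// divr_ge0. Qed.

Lemma om_le i : i \in sparse -> om i <= n%:R^-1.
Proof.
move=> /rare_le h; rewrite /om mulrA ler_piMl ?invr_ge0//.
by rewrite -ler_pdivlMr// div1r.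
Qed.

(** [None] carries the leftover mass, on which nothing is raised. *)
Definition sT : S -> R :=
  push (fun o : option 'I_n => if o is Some i then if i \in sparse then om i else 0
          else 1 - \sum_(i in sparse) om i)
       (fun o => if o is Some i then [set i] else set0).

Lemma big_option (F : option 'I_n -> R) : \sum_o F o = F None + \sum_i F (Some i).
Proof.
rewrite (bigD1 None)//=; congr (_ + _).
rewrite (reindex_omap (@Some 'I_n) id) => [|[i|]//].
by apply: eq_bigl => i; rewrite /= eqxx.
Qed.

Lemma dist_sT : dist sT.
Proof.
apply: dist_push; split=> [[i|]|].
- by case: ifP => // _; apply: om_ge0.
- rewrite subr_ge0; apply: (@le_trans _ _ (\sum_(i in sparse) n%:R^-1)).
    by apply: ler_sum => i; apply: om_le.
  rewrite sumr_const -[leLHS]mulr_natl ler_pdivrMr// mul1r ler_nat.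
  by rewrite -[leqRHS]card_ord max_card.
- by rewrite big_option -big_mkcond /= subrK.
Qed.

Lemma E_sT_step (H : S -> R) U :
  E sT (fun V => H (U :|: V)) - H U =
  \sum_(i in sparse) om i * (H (U :|: [set i]) - H U).
Proof.
rewrite E_push /E big_option setU0 [in RHS]big_mkcond /=.
have -> : \sum_i (if i \in sparse then om i else 0) * H (U :|: [set i]) =
  \sum_(i in sparse) om i * H (U :|: [set i]).
  by rewrite [in RHS]big_mkcond; apply: eq_bigr => i _; case: ifP; rewrite ?mul0r.
rewrite -big_mkcond /=.
have -> : \sum_(i in sparse) om i * (H (U :|: [set i]) - H U) =
    \sum_(i in sparse) om i * H (U :|: [set i]) - (\sum_(i in sparse) om i) * H U.
  by rewrite mulr_suml -sumrB; apply: eq_bigr => i _; rewrite mulrBr.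
by ring.
Qed.

(** * Random raises and random coalitions at fixed scales *)

Section Blocks.
Variables (Z : S) (t b : nat).
Hypotheses (t_gt0 : (0 < t)%N) (b_gt0 : (0 < b)%N).

Let t0 : 0 < t%:R :> R. Proof. by rewrite ltr0n. Qed.
Let b0 : 0 < b%:R :> R. Proof. by rewrite ltr0n. Qed.

Local Notation be := (blk (@unif1 R n) b).
Local Notation ta := (blk sT t).

Let dbe : dist be. Proof. exact/dist_blk/dist_unif1. Qed.
Let dta : dist ta. Proof. exact/dist_blk/dist_sT. Qed.
Let dwt : dist (wt p). Proof. exact: wt_dist. Qed.
Let be0 U : 0 <= be U. Proof. by case: dbe. Qed.
Let ta0 U : 0 <= ta U. Proof. by case: dta. Qed.
Let wt0 x : 0 <= wt p x. Proof. by case: dwt. Qed.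
Let dcp k : dist (cpow sT k). Proof. exact/dist_cpow/dist_sT. Qed.
Let cp0 k U : 0 <= cpow sT k U. Proof. by case: (dcp k). Qed.

(* The random coalition gains at most 1 in total while it grows, so at most
   [n / b] per round of additions once it has size [b]. *)
Lemma gain_le x : E be (fun B => \sum_i (g (i |: (Z :|: B)) x - g (Z :|: B) x)) <= n%:R / b%:R.
Proof.
apply: le_trans (unif1_gain n_gt0 b_gt0 (H := fun B => g (Z :|: B) x) _).
  apply: E_le => // B; apply: ler_sum => i _.
  by rewrite setUCA.
by move=> U; rewrite g_ge0 g_le1.
Qed.

(** If raising [i] turns failure into success, then so does adding [i] to the coalition. As
    [om i <= 1/n], the sum is at most 1/n times the bound n/b of [gain_le]. *)
Lemma raise1_gain_le x : E be (fun B => \sum_(i in sparse) om i *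
   (g (Z :|: B) (upd x i (rare i)) * (1 - g (Z :|: B) x))) <= b%:R^-1.
Proof.
apply: (@le_trans _ _ (n%:R^-1 * (n%:R / b%:R))); last by rewrite mulrA mulVf ?mul1r// gt_eqF.
apply: le_trans (ler_wpM2l _ (gain_le x)); last by rewrite invr_ge0 ltW.
rewrite -EZ; apply: E_le => // B; rewrite mulr_sumr big_mkcond; apply: ler_sum => i _.
have m : 0 <= g (i |: (Z :|: B)) x - g (Z :|: B) x by rewrite subr_ge0 g_mono// subsetUr.
have [si|_] := ifPn; last by rewrite mulr_ge0// invr_ge0 ltW.
apply: ler_pM; rewrite ?om_ge0 ?om_le//.
  by rewrite mulr_ge0 ?g_ge0// subr_ge0 g_le1.
move: m (g_upd (Z :|: B) x i (rare i)) (g_le1 (Z :|: B) (upd x i (rare i))).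
by case/orP: (g_bool (Z :|: B) x) => /eqP ->; lra.
Qed.

(** A success after k + 1 raises that was absent at the start is either present after k raises or
    created by the last one, and the latter costs 1/b. *)
Lemma raise_gain_le k x : E (cpow sT k) (fun T => E be (fun B =>
   g (Z :|: B) (raise x T) * (1 - g (Z :|: B) x))) <= k%:R / b%:R.
Proof.
elim: k => [|k IH].
  rewrite E_cpow0 raise0 mul0r -[leRHS](E_cst 0 dbe); apply: E_le => // B.
  by case/orP: (g_bool (Z :|: B) x) => /eqP ->; lra.
rewrite E_cpowSr -natr1 mulrDl div1r.
apply: (@le_trans _ _ (E (cpow sT k) (fun T =>
   E be (fun B => g (Z :|: B) (raise x T) * (1 - g (Z :|: B) x)) +
   E be (fun B => \sum_(i in sparse) om i *
   (g (Z :|: B) (upd (raise x T) i (rare i)) * (1 - g (Z :|: B) (raise x T))))))).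
  apply: E_le => // T; rewrite E_swap -ED; apply: E_le => // B.
  apply: (@le_trans _ _ (E sT (fun V => g (Z :|: B) (raise x T) * (1 - g (Z :|: B) x)
      + g (Z :|: B) (raise x (T :|: V)) * (1 - g (Z :|: B) (raise x T))))).
    apply: E_le => [|V]; first by case: dist_sT.
    move: (g_ge0 (Z :|: B) (raise x (T :|: V))) (g_le1 (Z :|: B) (raise x (T :|: V))).
    by case/orP: (g_bool (Z :|: B) x) => /eqP ->;
       case/orP: (g_bool (Z :|: B) (raise x T)) => /eqP ->; lra.
  rewrite ED E_cst ?lerD2l; last exact: dist_sT.
  have := E_sT_step (fun V => g (Z :|: B) (raise x V) * (1 - g (Z :|: B) (raise x T))) T.
  have -> : g (Z :|: B) (raise x T) * (1 - g (Z :|: B) (raise x T)) = 0.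
    by case/orP: (g_bool (Z :|: B) (raise x T)) => /eqP ->; ring.
  rewrite subr0 => ->; apply: ler_sum => i si; rewrite subr0.
  by rewrite raiseU raise1.
rewrite ED; apply: lerD IH _.
by apply: E_lec => // T; apply: raise1_gain_le.
Qed.

(** The success probability after [k] raises. By [level_dec] it is nonincreasing in [k] up to an
    error of 1/b per raise. *)
Definition level k := Ex (fun x => E (cpow sT k) (fun T => E be (fun B => g (Z :|: B) (raise x T)))).

Lemma level01 k : 0 <= level k <= 1.
Proof.
rewrite /level E_ge0//= => [|x]; last by apply: E_ge0 => // T; apply: E_ge0 => // B; apply: g_ge0.
by apply: E_lec => // x; apply: E_lec => // T; apply: E_lec => // B; apply: g_le1.
Qed.

Lemma level_dec j k : (j <= k)%N -> level k <= level j + (k - j)%:R / b%:R.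
Proof.
move=> jk; rewrite /level -{1}(subnKC jk).
rewrite -(E_cst ((k - j)%:R / b%:R) dwt) -ED; apply: E_le => // x.
rewrite E_cpowD -(E_cst ((k - j)%:R / b%:R) (dcp j)) -ED; apply: E_le => // T.
apply: le_trans (lerD (lexx _) (raise_gain_le (k - j) (raise x T))).
rewrite -(E_cst (E be _) (dcp (k - j))) -ED; apply: E_le => // V.
rewrite -ED; apply: E_le => // B; rewrite raiseU.
have := g_le1 (Z :|: B) (raise (raise x T) V); have := g_ge0 (Z :|: B) (raise (raise x T) V).
by case/orP: (g_bool (Z :|: B) (raise x T)) => /eqP ->; lra.
Qed.

Definition grown j := Ex (fun x => E ta (fun T => E ta (fun V =>
  E (cpow (@unif1 R n) j) (fun B => g (Z :|: B) (raise x (T :|: V)))))).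

Definition avg x : R := E ta (fun T => E be (fun B => g (Z :|: B) (raise x T))).

Lemma avg01 x : 0 <= avg x <= 1.
Proof.
rewrite /avg E_ge0//= => [|T]; last by apply: E_ge0 => // B; apply: g_ge0.
by apply: E_lec => // T; apply: E_lec => // B; apply: g_le1.
Qed.

Lemma raise_blk_gain_le x : E ta (fun T => E be (fun B =>
   g (Z :|: B) (raise x T) * (1 - g (Z :|: B) x))) <= (t + t)%:R / b%:R.
Proof.
apply: blk_le => // k /andP[_ kt].
by apply: le_trans (raise_gain_le k x) _; rewrite ler_pM2r ?invr_gt0// ler_nat ltnW.
Qed.

Let mean T := Ex (fun x => E be (fun B => g (Z :|: B) (raise x T))).

Let levelE k : level k = E (cpow sT k) mean.
Proof. exact: E_swap. Qed.

Let Ex_avgE : Ex avg = E ta mean.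
Proof. exact: E_swap. Qed.

Lemma Ex_avg_le k : (k <= t)%N -> Ex avg <= level k + (t + t)%:R / b%:R.
Proof.
move=> kt; rewrite Ex_avgE; apply: blk_le => // j /andP[tj jt].
rewrite -levelE; apply: le_trans (level_dec (leq_trans kt tj)) _.
by rewrite lerD2l ler_pM2r ?invr_gt0// ler_nat; lia.
Qed.

Lemma level_le_avg k : (t + t <= k)%N -> level k <= Ex avg + k%:R / b%:R.
Proof.
move=> tk; rewrite Ex_avgE -lerBlDr; apply: blk_ge => // j /andP[tj jt].
have jk : (j <= k)%N by lia.
rewrite -levelE lerBlDr; apply: le_trans (level_dec jk) _.
by rewrite lerD2l ler_pM2r ?invr_gt0// ler_nat leq_subr.
Qed.

(** The block indices satisfy [t <= j] and [j + k <= 4 * t], so near-monotonicity moves both means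
    to these endpoints, at a total cost of (3t - k)/b. *)
Lemma drop_le : E ta (fun T => E ta (fun V => mean T - mean (T :|: V))) <=
  level t - level (4 * t) + (3 * t)%:R / b%:R.
Proof.
apply: blk2_le => // j k /andP[tj jt] /andP[tk kt].
under [X in E _ X <= _]funext do rewrite E_cB//.
rewrite EB -E_cpowD -!levelE.
have h1 := level_dec tj; have jk4 : (j + k <= 4 * t)%N by lia.
have h2 := level_dec jk4.
have h3 : (j - t)%:R / b%:R + (4 * t - (j + k))%:R / b%:R <= (3 * t)%:R / b%:R :> R.
  by rewrite -mulrDl -natrD ler_pM2r ?invr_gt0// ler_nat; lia.
by lra.
Qed.

(* For independent pairs [(T, B)] and [(V, B')], passing from one to the other
   through the unions costs only what the scales [t] and [b] still have to lose
   or gain, so [avg] is almost Boolean. *)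
Lemma near_bool : Ex (fun x => avg x * (1 - avg x)) <=
  (level t - level (4 * t)) + (grown (4 * b) - grown b) + (7 * t)%:R / b%:R.
Proof.
pose q H := Ex (fun x => E ta (fun T => E ta (fun V => E be (fun B => E be (fun B' =>
  H x T V B B' : R))))).
have q_le H K : (forall x T V B B', H x T V B B' <= K x T V B B') -> q H <= q K.
  by move=> h; do 5!(apply: E_le => // ?).
have qD H K : q (fun x T V B B' => H x T V B B' + K x T V B B') = q H + q K.
  rewrite -ED; congr E; apply/funext => x; rewrite -ED; congr E; apply/funext => T.
  rewrite -ED; congr E; apply/funext => V; rewrite -ED; congr E; apply/funext => B.
  by rewrite -ED.
have -> : Ex (fun x => avg x * (1 - avg x)) =
    q (fun x T V B B' => g (Z :|: B) (raise x T) * (1 - g (Z :|: B') (raise x V))).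
  congr E; apply/funext => x; rewrite /avg -E_cB// E_mul.
  congr E; apply/funext => T; congr E; apply/funext => V.
  by rewrite -E_cB// E_mul.
pose H1 x T V B (B' : S) := g (Z :|: B) (raise x T) - g (Z :|: B) (raise x (T :|: V)).
pose H2 x T V B (B' : S) := g (Z :|: B) (raise x (T :|: V)) * (1 - g (Z :|: B) (raise x T)).
pose H3 x T V B B' := g (Z :|: (B :|: B')) (raise x (T :|: V)) - g (Z :|: B') (raise x (T :|: V)).
pose H4 x T V (B B' : S) := g (Z :|: B') (raise x (T :|: V)) * (1 - g (Z :|: B') (raise x V)).
(* Pass from (T, B) to (T :|: V, B), then to (T :|: V, B'), then to (V, B'). If the first succeeds
   and the last fails, then raising [V] destroys a success ([H1]), or [B'] gains by absorbing [B]
   ([H3]), or raising [T] creates a success ([H4]). [H2] compensates the points where [H1] is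
   negative. *)
apply: (@le_trans _ _ (q H1 + q H2 + q H3 + q H4)).
  rewrite -!qD; apply: q_le => x T V B B'; rewrite /H1 /H2 /H3 /H4.
  have := g_le1 (Z :|: (B :|: B')) (raise x (T :|: V)).
  have : g (Z :|: B) (raise x (T :|: V)) <= g (Z :|: (B :|: B')) (raise x (T :|: V)).
    by apply: g_mono; rewrite setUA subsetUl.
  have : g (Z :|: B') (raise x (T :|: V)) <= g (Z :|: (B :|: B')) (raise x (T :|: V)).
    by apply: g_mono; rewrite setUS// subsetUr.
  move: (g (Z :|: (B :|: B')) _) => h.
  case/orP: (g_bool (Z :|: B) (raise x T)) => /eqP ->;
  case/orP: (g_bool (Z :|: B') (raise x V)) => /eqP ->;
  case/orP: (g_bool (Z :|: B) (raise x (T :|: V))) => /eqP ->;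
  case/orP: (g_bool (Z :|: B') (raise x (T :|: V))) => /eqP ->; lra.
have h1 : q H1 <= level t - level (4 * t) + (3 * t)%:R / b%:R.
  apply: le_trans drop_le; rewrite /q /H1 E_swap; apply: E_le => // T.
  rewrite E_swap; apply: E_le => // V; rewrite -EB; apply: E_le => // x.
  by rewrite -EB; apply: E_le => // B; rewrite E_cst.
have h2 : q H2 <= (t + t)%:R / b%:R.
  apply: E_lec => // x; apply: E_lec => // T.
  apply: le_trans (raise_blk_gain_le (raise x T)); apply: E_le => // V; apply: E_le => // B.
  by rewrite E_cst// /H2 raiseU.
have h3 : q H3 <= grown (4 * b) - grown b.
  rewrite -EB; apply: E_le => // x; rewrite -EB; apply: E_le => // T.
  rewrite -EB; apply: E_le => // V; apply: blk_inc (dist_unif1 _ _) _ => // U W UW.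
  by apply: g_mono; apply: setUS.
have h4 : q H4 <= (t + t)%:R / b%:R.
  apply: E_lec => // x; rewrite E_swap; apply: E_lec => // V.
  apply: le_trans (raise_blk_gain_le (raise x V)); apply: E_le => // T.
  rewrite E_swap; apply: E_le => // B'.
  by rewrite E_cst// /H4 [T :|: V]setUC raiseU.
have : (t + t)%:R / b%:R + (t + t)%:R / b%:R + (3 * t)%:R / b%:R = (7 * t)%:R / b%:R :> R.
  by rewrite -!mulrDl -!natrD; congr (_%:R / _); lia.
by lra.
Qed.

Let sq_le (a : R) : `|a| <= 1 -> a ^+ 2 <= `|a|.
Proof. by move=> a1; rewrite -real_normK ?num_real// expr2 ler_piMr. Qed.

Let Di_le1 i x : `|Di i avg x| <= 1.
Proof.
rewrite /Di; have /andP[] := avg01 (upd x i true); have /andP[] := avg01 (upd x i false).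
by move=> *; rewrite ler_norml; apply/andP; split; lra.
Qed.

(** The squared derivative is at most its absolute value, since [avg] lies in [0, 1]. Setting the
    bit to its rare value changes [x] only when the bit has the common value, which supplies the
    other factor of the variance. *)
Lemma sparse_dev i : i \in sparse ->
  Ex (fun x => (avg x - Ei p i avg x) ^+ 2) <=
  p i (rare i) * Ex (fun x => `|avg x - avg (upd x i (rare i))|).
Proof.
move=> si; rewrite var_Ei// -(Ex_Ei p_sum1 i (fun x => `|_|)) -EZ.
apply: E_le => // x; have := sq_le (Di_le1 i x).
rewrite /Ei !upd_same /Di.
case: (rare i); rewrite subrr normr0 mulr0 ?add0r ?addr0 => h.
  rewrite mulrA distrC; apply: ler_wpM2l h; by rewrite mulr_ge0.
by rewrite [leRHS]mulrA [p i false * _]mulrC; apply: ler_wpM2l h; rewrite mulr_ge0.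
Qed.

(** For Boolean values |u - v| = (u - v) + 2v(1 - u). The signed part is a step of [sT] and
    telescopes over the block; the upward part is small by [raise1_gain_le]. *)
Lemma sparse_sum :
  \sum_(i in sparse) Ex (fun x => (avg x - Ei p i avg x) ^+ 2) <=
  n%:R / Th%:R * ((level t - level (t + t)) / t%:R + 2 / b%:R).
Proof.
pose c : R := n%:R / Th%:R.
have pE i : p i (rare i) = c * om i by rewrite /c /om; field; rewrite !gt_eqF.
have c0 : 0 <= c by rewrite divr_ge0.
pose H T x B i := g (Z :|: B) (raise x T) - g (Z :|: B) (raise x (T :|: [set i])).
pose K T x B i := g (Z :|: B) (raise x (T :|: [set i])) * (1 - g (Z :|: B) (raise x T)).
apply: (@le_trans _ _ (\sum_(i in sparse) c * (om i * Ex (fun x => E ta (fun T =>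
   E be (fun B => H T x B i + 2 * K T x B i)))))).
  apply: ler_sum => i si; apply: le_trans (sparse_dev si) _.
  rewrite pE -mulrA; apply: ler_wpM2l => //; apply: ler_wpM2l; first exact: om_ge0.
  apply: E_le => // x; rewrite /avg -EB; apply: le_trans (E_abs _ _) _ => //.
  apply: E_le => // T; rewrite -EB; apply: le_trans (E_abs _ _) _ => //.
  apply: E_le => // B; rewrite raise_upd_sparse// /H /K.
  case/orP: (g_bool (Z :|: B) (raise x T)) => /eqP ->;
  case/orP: (g_bool (Z :|: B) (raise x (T :|: [set i]))) => /eqP ->;
  by rewrite ler_norml; apply/andP; split; lra.
rewrite -mulr_sumr; apply: ler_wpM2l => //.
have -> : \sum_(i in sparse) om i * Ex (fun x => E ta (fun T =>
     E be (fun B => H T x B i + 2 * K T x B i))) =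
   - E ta (fun T => \sum_(i in sparse) om i * (mean (T :|: [set i]) - mean T)) +
   2 * Ex (fun x => E ta (fun T => E be (fun B => \sum_(i in sparse) om i * K T x B i))).
  have -> : Ex (fun x => E ta (fun T => E be (fun B => \sum_(i in sparse) om i * K T x B i))) =
     \sum_(i in sparse) om i * Ex (fun x => E ta (fun T => E be (fun B => K T x B i))).
    under [X in E _ X]funext => x.
      under [X in E _ X]funext => T.
        rewrite E_sum; under eq_bigr do rewrite EZ.
        over.
      rewrite E_sum; under eq_bigr do rewrite EZ.
      over.
    by rewrite E_sum; under eq_bigr do rewrite EZ.
  rewrite E_sum mulr_sumr -sumrN -big_split /=; apply: eq_bigr => i _.
  rewrite EZ mulrCA -mulrN -mulrDr; congr (_ * _).
  rewrite EB opprB -[E ta mean]E_swap -[E ta (fun T => mean _)]E_swap -EB -EZ -ED.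
  congr E; apply/funext => x; rewrite -EB -EZ -ED; congr E; apply/funext => T.
  by rewrite -EB -EZ -ED.
under [X in - E ta X]funext do rewrite -E_sT_step.
rewrite E_blk_step -!levelE; apply: lerD.
  by rewrite -mulrN opprB mulrC.
apply: ler_wpM2l => //; apply: E_lec => // x; apply: E_lec => // T.
apply: le_trans (raise1_gain_le (raise x T)); apply: E_le => // B.
rewrite le_eqVlt; apply/orP; left; apply/eqP; apply: eq_bigr => i si.
by rewrite /K raiseU raise1.
Qed.

Definition gain i := Ex (fun x => E ta (fun T => E be (fun B =>
  g (i |: (Z :|: B)) (raise x T) - g (Z :|: B) (raise x T)))).

Lemma gain_ge0 i : 0 <= gain i.
Proof.
apply: E_ge0 => // x; apply: E_ge0 => // T; apply: E_ge0 => // B.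
by rewrite subr_ge0 g_mono// subsetUr.
Qed.

Lemma gain_sum : \sum_i gain i <= n%:R / b%:R.
Proof.
rewrite /gain -E_sum; apply: E_lec => // x; rewrite -E_sum; apply: E_lec => // T.
by rewrite -E_sum; apply: gain_le.
Qed.

(** Changing bit [i] helps at most as much as adding [i] to the coalition. Each value of a dense bit
    has probability above 1/Th, so the gains at the two values sum to at most Th times their
    mean. *)
Lemma dense_dev i : i \notin sparse -> Ex (fun x => `|avg x - Ei p i avg x|) <= Th%:R * gain i.
Proof.
move=> si; pose a x := E ta (fun T => E be (fun B =>
  g (i |: (Z :|: B)) (raise x T) - g (Z :|: B) (raise x T))).
have a0 x : 0 <= a x.
  by apply: E_ge0 => // T; apply: E_ge0 => // B; rewrite subr_ge0 g_mono// subsetUr.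
have [pt pf] : Th%:R^-1 < p i true /\ Th%:R^-1 < p i false.
  by move: si; rewrite inE negb_or -!ltNge => /andP.
have step x c d : avg (upd x i c) - avg (upd x i d) <= a (upd x i d).
  rewrite /avg /a -EB; apply: E_le => // T; rewrite -EB; apply: E_le => // B.
  rewrite lerD2r !raise_upd_dense// -(upd_same _ i d); exact: g_upd.
rewrite -(Ex_Ei p_sum1 i (fun x => `|_|)) /gain -/a -(Ex_Ei p_sum1 i a) -EZ.
apply: E_le => // x; rewrite /Ei !upd_same.
move: (step x true false) (step x false true) (a0 (upd x i true)) (a0 (upd x i false)).
set u := avg _; set v := avg _; set au := a _; set av := a _ => s1 s2 au0 av0.
have uv : `|u - v| <= au + av by rewrite ler_norml; apply/andP; split; lra.
have := p_sum1 i => ps; have := p_ge0 i true => pt0; have := p_ge0 i false => pf0.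
have -> : u - (p i true * u + p i false * v) = p i false * (u - v).
  have -> : p i true = 1 - p i false by lra.
  by ring.
have -> : v - (p i true * u + p i false * v) = p i true * (v - u).
  have -> : p i true = 1 - p i false by lra.
  by ring.
rewrite !normrM (ger0_norm pt0) (ger0_norm pf0) [`|v - u|]distrC.
apply: (@le_trans _ _ (au + av)).
  have h : p i true * p i false <= 4^-1.
    by have := sqr_ge0 (p i true - p i false); nra.
  have h0 := normr_ge0 (u - v).
  have : p i true * p i false * `|u - v| <= 4^-1 * `|u - v| by apply: ler_wpM2r.
  by rewrite mulrA [_ * (_ * _)]mulrA [p i false * p i true]mulrC; lra.
have k1 : 1 <= Th%:R * p i true by rewrite -ler_pdivrMl// mulr1 ltW.
have k2 : 1 <= Th%:R * p i false by rewrite -ler_pdivrMl// mulr1 ltW.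
have h1 : 0 <= (Th%:R * p i false - 1) * au by rewrite mulr_ge0// subr_ge0.
have h2 : 0 <= (Th%:R * p i true - 1) * av by rewrite mulr_ge0// subr_ge0.
by lra.
Qed.

(** With m the mean of [avg], m(1 - m) is the mean of avg(1 - avg) plus the variance. The first is
    [near_bool]; [variance_le] splits the second over sparse and dense coordinates. *)
Lemma variance_avg k (eta : R) : (2 * Th <= 2 ^ k)%N ->
    (forall i, gain i <= eta) ->
  Ex avg * (1 - Ex avg) <=
  (level t - level (4 * t)) + (grown (4 * b) - grown b) + (7 * t)%:R / b%:R +
  n%:R / Th%:R * ((level t - level (t + t)) / t%:R + 2 / b%:R) +
  (2 ^ k)%:R^-1 * (Th%:R * (n%:R / b%:R)) +
  4 ^+ (2 ^ (k + k + 2))%N * (Th%:R ^+ 2 * eta * (n%:R / b%:R)).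
Proof.
move=> Thk ge; pose r : R := (2 * Th)%:R.
have r0 : 0 < r by rewrite ltr0n; lia.
have rk : r <= (2 ^ k)%:R by rewrite ler_nat.
(* For a dense bit the smaller probability exceeds 1/Th and the larger is at least 1/2, hence the
   choice [r = 2 * Th]. *)
have D i : i \in ~: sparse -> r^-1 <= p i true * p i false.
  rewrite !inE negb_or -!ltNge => /andP[pt pf].
  have T2 : 2 <= Th%:R :> R by rewrite ler_nat.
  have i2 : Th%:R^-1 <= 2^-1 :> R by rewrite lef_pV2 ?posrE.
  have i0 : 0 < Th%:R^-1 :> R by rewrite invr_gt0.
  rewrite /r natrM invfM; have := p_sum1 i => ps.
  have [h|h] := leP (p i true) 2^-1.
    by rewrite mulrC; apply: ler_pM; lra.
  by apply: ler_pM; lra.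
have := variance_le p_ge0 p_sum1 avg r0 rk D.
rewrite setCK => hv; have hs := sparse_sum; have hb := near_bool.
have -> : Ex avg * (1 - Ex avg) =
    Ex (fun x => avg x * (1 - avg x)) + (Ex (fun x => avg x ^+ 2) - Ex avg ^+ 2).
  have -> : (fun x => avg x * (1 - avg x)) = fun x => avg x - avg x ^+ 2.
    by apply/funext => x; ring.
  by rewrite EB; ring.
have gs : \sum_(i in ~: sparse) gain i <= n%:R / b%:R.
  apply: le_trans gain_sum; rewrite big_mkcond; apply: ler_sum => i _.
  by case: ifP => // _; apply: gain_ge0.
have dev1 i x : `|avg x - Ei p i avg x| <= 1.
  have /andP[a0 a1] := avg01 x.
  have e0 : 0 <= Ei p i avg x by apply: Ei_ge0 => // y; case/andP: (avg01 y).
  have e1 : Ei p i avg x <= 1.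
    have := Ei_le p_ge0 i (F := avg) (G := fun=> 1) x.
    rewrite {2}/Ei !mulr1 p_sum1; apply => y; by case/andP: (avg01 y).
  by rewrite ler_norml; apply/andP; split; lra.
have d1 : \sum_(i in ~: sparse) Ex (fun x => (avg x - Ei p i avg x) ^+ 2) <=
    Th%:R * (n%:R / b%:R).
  apply: le_trans (_ : _ <= Th%:R * \sum_(i in ~: sparse) gain i) _; last by apply: ler_wpM2l gs; exact: ltW.
  rewrite mulr_sumr; apply: ler_sum => i; rewrite inE => si.
  apply: le_trans (dense_dev si); apply: E_le => // x; exact/sq_le/dev1.
have d2 : \sum_(i in ~: sparse) Ex (fun x => `|avg x - Ei p i avg x|) ^+ 2 <=
    Th%:R ^+ 2 * eta * (n%:R / b%:R).
  have eta0 : 0 <= eta by apply: le_trans (ge (Ordinal n_gt0)); apply: gain_ge0.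
  apply: le_trans (_ : _ <= Th%:R ^+ 2 * eta * \sum_(i in ~: sparse) gain i) _; last first.
    by apply: ler_wpM2l => //; rewrite mulr_ge0 ?sqr_ge0.
  rewrite mulr_sumr; apply: ler_sum => i; rewrite inE => si.
  have h0 : 0 <= Ex (fun x => `|avg x - Ei p i avg x|) by apply: E_ge0.
  have g0 := gain_ge0 i; have tg : 0 <= Th%:R * gain i by rewrite mulr_ge0// ltW.
  apply: (@le_trans _ _ ((Th%:R * gain i) ^+ 2)).
    by rewrite ler_pXn2r ?nnegrE ?dense_dev.
  rewrite exprMn -mulrA; apply: ler_wpM2l; first exact: sqr_ge0.
  by rewrite expr2; apply: ler_wpM2r.
have k0 : 0 <= (2 ^ k)%:R^-1 :> R by rewrite invr_ge0.
have c0 : 0 <= 4 ^+ (2 ^ (k + k + 2))%N :> R by apply: exprn_ge0.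
have := ler_wpM2l k0 d1; have := ler_wpM2l c0 d2.
move: hv hs hb; set q1 := \sum_(i in sparse) _; set q2 := \sum_(i in ~: sparse) _.
by set q3 := \sum_(i in ~: sparse) _; lra.
Qed.

End Blocks.
End SingleRound.

(** * Choice of the set [Z] and of the scales *)

Lemma saturate (R : realFieldType) (I : finType) (Phi : {set I} -> R) (eta : R) (h : nat) :
    0 < eta -> (forall Z, 0 <= Phi Z <= h%:R * eta) ->
  exists2 Z : {set I}, (#|Z| <= h)%N & forall i, Phi (i |: Z) - Phi Z <= eta.
Proof.
move=> eta0 Phi01.
(* Greedy choice: include a player as long as some player adds more than [eta]. After [h] inclusions
   [Phi] has reached its upper bound [h * eta], so nobody can add anything. *)
have step m : (exists2 Z : {set I}, (#|Z| <= m)%N & forall i, Phi (i |: Z) - Phi Z <= eta) \/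
    (exists2 Z : {set I}, (#|Z| <= m)%N & m%:R * eta <= Phi Z).
  elim: m => [|m [[Z Zm gZ]|[Z Zm gZ]]].
  - by right; exists set0; rewrite ?cards0// mul0r; case/andP: (Phi01 set0).
  - by left; exists Z => //; apply: leqW.
  have [/forallP good|] := boolP [forall i, Phi (i |: Z) - Phi Z <= eta].
    by left; exists Z => //; apply: leqW.
  rewrite negb_forall => /existsP[i]; rewrite -ltNge => hi; right; exists (i |: Z).
    by rewrite cardsU1; case: (i \notin Z); rewrite ?add0n ?add1n ?ltnS// leqW.
  by rewrite -natr1; lra.
have [//|[Z Zh hZ]] := step h; exists Z => // i.
by have /andP[_] := Phi01 (i |: Z); lra.
Qed.

(** On the L by L grid of scales every line of differences telescopes to at most 1, so the sum over
    L^2 cells is at most 3L. The drop has weight 2 because it enters the variance bound through both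
    [near_bool] and [sparse_sum]. *)
Lemma pigeonhole2 (R : realFieldType) (L : nat) (u v : nat -> nat -> R) : (0 < L)%N ->
    (forall l' l, 0 <= u l' l <= 1) -> (forall l l', 0 <= v l l' <= 1) ->
  exists l l' : 'I_L,
    2 * (u l' l - u l' l.+1) + (v l l'.+1 - v l l') <= 3 * L%:R^-1.
Proof.
move=> L0 u01 v01; apply/not_existsP => h; have LR : 0 < L%:R :> R by rewrite ltr0n.
pose c : R := 3 * L%:R^-1; pose D (l l' : 'I_L) := 2 * (u l' l - u l' l.+1) + (v l l'.+1 - v l l').
have big : \sum_(l < L) \sum_(l' < L) c < \sum_(l < L) \sum_(l' < L) D l l'.
  have lt1 (l : 'I_L) : \sum_(l' < L) c < \sum_(l' < L) D l l'.
    apply: ltr_sum => [|l' _]; first by apply/hasP; exists (Ordinal L0); rewrite ?mem_index_enum.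
    by rewrite ltNge; apply/negP => hl; apply: (h l); exists l'.
  apply: ltr_sum => [|l _]; [by apply/hasP; exists (Ordinal L0); rewrite ?mem_index_enum | exact: lt1].
have := big; apply/negP; rewrite -leNgt.
have -> : \sum_(l < L) \sum_(l' < L) c = 3 * L%:R.
  rewrite !sumr_const card_ord -mulrnA -[LHS]mulr_natl natrM /c; field; lra.
have tel (w : nat -> R) : \sum_(l < L) (w l.+1 - w l) = w L - w 0%N.
  by rewrite -(big_mkord xpredT (fun l => w l.+1 - w l)) telescope_sumr.
under eq_bigr do rewrite big_split.
rewrite big_split /= exchange_big /=.
have h1 : \sum_(l' < L) \sum_(l < L) 2 * (u l' l - u l' l.+1) <= 2 * L%:R.
  rewrite mulr_natr -[in leRHS](card_ord L) -sumr_const; apply: ler_sum => l' _.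
  rewrite -mulr_sumr; under eq_bigr do rewrite -opprB.
  by rewrite sumrN tel; have := u01 l' L; have := u01 l' 0%N; lra.
have h2 : \sum_(l < L) \sum_(l' < L) (v l l'.+1 - v l l') <= L%:R.
  have -> : L%:R = \sum_(l < L) (1 : R) by rewrite sumr_const card_ord.
  apply: ler_sum => l _; rewrite tel.
  by have := v01 l L; have := v01 l 0%N; lra.
by lra.
Qed.

Section Dichotomy.
Variables (R : realFieldType) (n : nat) (p : 'I_n -> bool -> R).
Hypothesis p_ge0 : forall i b, 0 <= p i b.
Hypothesis p_sum1 : forall i, p i true + p i false = 1.
Hypothesis n_gt0 : (0 < n)%N.
Local Notation X := (bits 'I_n).
Local Notation Ex := (E (wt p)).
Variables (Th L t0 b0 k h : nat) (Delta eta e : R) (A : pred X).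
Hypotheses (Th_gt1 : (1 < Th)%N) (L_gt0 : (0 < L)%N).
Hypotheses (t0_gt0 : (0 < t0)%N) (b0_gt0 : (0 < b0)%N).
Hypotheses (Thk : (2 * Th <= 2 ^ k)%N) (eta_gt0 : 0 < eta).
Hypotheses (h_eta : (L ^ 2)%:R <= h%:R * eta :> R).
Hypotheses (nb0 : n%:R / b0%:R <= Delta) (nt0 : n%:R / Th%:R <= t0%:R :> R).
Hypotheses (L_e : L%:R^-1 <= e :> R) (s_e : (4 ^ L * t0)%:R / b0%:R <= e).
Hypothesis Q_e : (2 ^ k)%:R^-1 * (Th%:R * Delta) <= e.
Hypothesis eta_e : 4 ^+ (2 ^ (k + k + 2))%N * (Th%:R ^+ 2 * eta * Delta) <= e.

Let tl l := (4 ^ l * t0)%N.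
Let bl l := (4 ^ l * b0)%N.

Let tl0 l : (0 < tl l)%N. Proof. by rewrite muln_gt0 expn_gt0. Qed.
Let bl0 l : (0 < bl l)%N. Proof. by rewrite muln_gt0 expn_gt0. Qed.
Let tlS l : tl l.+1 = (4 * tl l)%N. Proof. by rewrite /tl expnS mulnA. Qed.
Let blS l : bl l.+1 = (4 * bl l)%N. Proof. by rewrite /bl expnS mulnA. Qed.

(** Both alternatives are stated at the top scales, so that neither the law of the raised input nor
    that of the random coalition depends on [A] or on the scales selected; only [Z] does. *)
Lemma dichotomy : exists2 Z : {set 'I_n}, (#|Z| <= h)%N &
  Ex (fun x => E (cpow (sT p Th) (4 ^ L * t0)) (fun T => (A (raise p Th x T))%:R)) <= 20 * e \/
  1 - 20 * e <= E (cpow (@unif1 R n) (4 ^ L * b0)) (fun B => Ex (g R A (Z :|: B))).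
Proof.
have Th0 : 0 < Th%:R :> R by rewrite ltr0n ltnW.
have nR : 0 < n%:R :> R by rewrite ltr0n.
have tR l : 0 < (tl l)%:R :> R by rewrite ltr0n.
have bR l : 0 < (bl l)%:R :> R by rewrite ltr0n.
have e0 : 0 < e by apply: lt_le_trans L_e; rewrite invr_gt0 ltr0n.
have dwt : dist (wt p) by apply: wt_dist.
have wt0 x : 0 <= wt p x by case: dwt.
have dT j : dist (cpow (sT p Th) j) by apply/dist_cpow/dist_sT.
have dB l : dist (blk (@unif1 R n) (bl l)) by apply/dist_blk/dist_unif1.
(* Summing over all scales allows [Z] to be fixed before the scales are chosen. The terms lie in
   [0, 1], so [Phi] is at most [L ^ 2]; all gains are nonnegative, so each single one is at most
   [eta]. *)
pose Phi Z : R := \sum_(l < L) \sum_(l' < L) Ex (avg p A Th Z (tl l) (bl l')).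
have m01 Z l l' : 0 <= Ex (avg p A Th Z (tl l) (bl l')) <= 1.
  have a01 := avg01 p_ge0 n_gt0 A Th_gt1 Z (tl0 l) (bl0 l').
  rewrite E_ge0//= => [|x]; last by case/andP: (a01 x).
  by apply: E_lec => // x; case/andP: (a01 x).
have [Z Zh satZ] : exists2 Z : {set 'I_n}, (#|Z| <= h)%N & forall i, Phi (i |: Z) - Phi Z <= eta.
  apply: saturate => // Z; apply/andP; split.
    by apply: sumr_ge0 => l _; apply: sumr_ge0 => l' _; case/andP: (m01 Z l l').
  apply: le_trans h_eta; apply: (@le_trans _ _ (\sum_(l < L) \sum_(l' < L) 1)).
    by apply: ler_sum => l _; apply: ler_sum => l' _; case/andP: (m01 Z l l').
  by rewrite !sumr_const card_ord -mulrnA expnS expn1.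
exists Z => //.
have gainE Y t b i : gain p A Th Y t b i = Ex (avg p A Th (i |: Y) t b) - Ex (avg p A Th Y t b).
  rewrite /gain -EB; congr E; apply/funext => x; rewrite /avg -EB; congr E; apply/funext => T.
  by rewrite -EB; congr E; apply/funext => B; rewrite setUA.
have gain_eta (l l' : 'I_L) i : gain p A Th Z (tl l) (bl l') i <= eta.
  have g0 (j j' : 'I_L) : 0 <= gain p A Th Z (tl j) (bl j') i.
    exact: gain_ge0.
  apply: le_trans (satZ i); rewrite /Phi -sumrB (bigD1 l)//= -sumrB (bigD1 l')//= -gainE -addrA.
  rewrite lerDl addr_ge0 ?sumr_ge0// => j _; first by rewrite -gainE.
  by rewrite -sumrB sumr_ge0// => j' _; rewrite -gainE.
pose u l' l := level p A Th Z (bl l') (tl l).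
pose v l l' := grown p A Th Z (tl l) (bl l').
have u01 l' l : 0 <= u l' l <= 1 by apply: level01.
have v01 l l' : 0 <= v l l' <= 1.
  have dta : dist (blk (sT p Th) (tl l)) by apply/dist_blk/dist_sT.
  have ta0 U : 0 <= blk (sT p Th) (tl l) U by case: dta.
  have dc : dist (cpow (@unif1 R n) (bl l')) by apply/dist_cpow/dist_unif1.
  have dc0 U : 0 <= cpow (@unif1 R n) (bl l') U by case: dc.
  rewrite /v /grown; apply/andP; split.
    by do 4!(apply: E_ge0 => // ?); exact: g_ge0.
  by do 4!(apply: E_lec => // ?); exact: g_le1.
have [l [l' uv]] := pigeonhole2 L_gt0 u01 v01.
set t := tl l; set b := bl l'.
have b_gt0 : (0 < b)%N by apply: bl0.
have t_gt0 : (0 < t)%N by apply: tl0.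
have tR' : 0 < t%:R :> R by rewrite ltr0n.
have bR' : 0 < b%:R :> R by rewrite ltr0n.
have tb : (4 * t)%:R / b%:R <= e.
  apply: le_trans s_e; apply: ler_pM; rewrite ?invr_ge0//.
    by rewrite ler_nat -tlS /tl leq_pmul2r// leq_exp2l.
  by rewrite lef_pV2 ?posrE// ?ltr0n// ler_nat /b /bl leq_pmull// expn_gt0.
have tb' : t%:R / b%:R <= e / 4 by move: tb; rewrite natrM -mulrA; lra.
have tb0 : 0 <= t%:R / b%:R :> R by rewrite divr_ge0.
have nb : n%:R / b%:R <= Delta.
  apply: le_trans nb0; apply: ler_pM; rewrite ?invr_ge0//.
  by rewrite lef_pV2 ?posrE// ?ltr0n// ler_nat /b /bl leq_pmull// expn_gt0.
have nt : n%:R / Th%:R <= t%:R :> R.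
  by apply: le_trans nt0 _; rewrite ler_nat /t /tl leq_pmull// expn_gt0.
have := variance_avg p_ge0 p_sum1 n_gt0 (A := A) Th_gt1 (tl0 l) (bl0 l') Thk (gain_eta l l').
set m := Ex _; rewrite -/t -/b.
have dl i j : (i <= j)%N -> level p A Th Z b j <= level p A Th Z b i + (j - i)%:R / b%:R.
  by move=> ij; apply: level_dec.
set l1 := level _ _ _ _ _ t; set l4 := level _ _ _ _ _ (4 * t); set l2 := level _ _ _ _ _ (t + t).
set G4 := grown _ _ _ _ _ (4 * b); set G1 := grown _ _ _ _ _ b.
have uv' : 2 * (l1 - l4) + (G4 - G1) <= 3 * e.
  by move: uv; rewrite /u /v tlS blS => /le_trans; apply; rewrite ler_pM2l.
have d1 : l4 <= l1 + 3 * (t%:R / b%:R).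
  have := @dl t (4 * t)%N; have -> : (4 * t - t = 3 * t)%N by rewrite -{2}[t]mul1n -mulnBl.
  rewrite natrM -mulrA.
  by apply; rewrite leq_pmull.
have d2 : l4 <= l2 + 2 * (t%:R / b%:R).
  have := @dl (t + t)%N (4 * t)%N.
  have -> : (4 * t - (t + t) = 2 * t)%N by rewrite addnn -mul2n -mulnBl.
  rewrite natrM -mulrA.
  by apply; rewrite addnn -mul2n leq_mul2r orbT.
have hsp : n%:R / Th%:R * ((l1 - l2) / t%:R + 2 / b%:R) <=
    (l1 - l4) + 7 * (t%:R / b%:R).
  pose c : R := n%:R / Th%:R; have c0 : 0 <= c by rewrite divr_ge0.
  pose Y : R := (l1 - l4) + 5 * (t%:R / b%:R); have Y0 : 0 <= Y by rewrite /Y; lra.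
  rewrite -/c mulrDr; have h1 : c * ((l1 - l2) / t%:R) <= Y.
    apply: (@le_trans _ _ (c * (Y / t%:R))).
      apply: ler_wpM2l => //; rewrite ler_pM2r ?invr_gt0//.
      by rewrite /Y; lra.
    by rewrite mulrCA ler_piMr// ler_pdivrMr// mul1r.
  have h2 : c * (2 / b%:R) <= 2 * (t%:R / b%:R).
    by rewrite mulrCA; apply: ler_wpM2l => //; rewrite ler_pM2r ?invr_gt0.
  by move: h1; rewrite /Y; lra.
have Q0 : 0 <= (2 ^ k)%:R^-1 :> R by rewrite invr_ge0.
have hQ : (2 ^ k)%:R^-1 * (Th%:R * (n%:R / b%:R)) <= e.
  by apply: le_trans Q_e; apply: ler_wpM2l => //; apply: ler_wpM2l => //; apply: ltW.
have hE : 4 ^+ (2 ^ (k + k + 2))%N * (Th%:R ^+ 2 * eta * (n%:R / b%:R)) <= e.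
  apply: le_trans eta_e; apply: ler_wpM2l; first exact: exprn_ge0.
  by apply: ler_wpM2l => //; rewrite mulr_ge0 ?sqr_ge0// ltW.
move: hsp hQ hE; rewrite natrM -mulrA.
set x1 := _ * (_ / _ + _); set x2 := _^-1 * _; set x3 := 4 ^+ _ * _ => hsp hQ hE hm.
(* The contributions are 3e from the chosen scales, 14t/b <= 3.5e, and at most e from each of the
   two dense terms. *)
have {hm} hm : m * (1 - m) <= 9 * e by lra.
have /andP[m0 m1] : 0 <= m <= 1 by apply: m01.
have [mhalf|mhalf] := leP m 2^-1.
  left; have mle : m <= 18 * e by nra.
  apply: (@le_trans _ _ (level p A Th Z b (tl L))); last first.
    have tL : (t + t <= tl L)%N.
      apply: (@leq_trans (4 * t)); first by rewrite addnn -mul2n leq_mul2r orbT.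
      by rewrite -tlS /tl leq_pmul2r// leq_exp2l.
    have := level_le_avg p_ge0 p_sum1 n_gt0 A Th_gt1 Z (tl0 l) (bl0 l') tL.
    rewrite -/b -/m; have : (tl L)%:R / b%:R <= e.
      apply: le_trans s_e; rewrite ler_pM2l// lef_pV2 ?posrE// ?ltr0n//.
      by rewrite ler_nat /b /bl leq_pmull// expn_gt0.
    by lra.
  apply: E_le => // x; apply: E_le => [T|T]; first by case: (dT (tl L)).
  rewrite -(E_cst (A _)%:R (dB l')); apply: E_le => [B|B]; first by case: (dB l').
  rewrite /g; case: (boolP (A (raise p Th x T))) => // Ax.
  suff -> : reach A (Z :|: B) (raise p Th x T) by [].
  by apply/reachP; exists (raise p Th x T).
right; have mge : 1 - 18 * e <= m by nra.
have h0 := Ex_avg_le p_ge0 p_sum1 n_gt0 A Th_gt1 Z (tl0 l) (bl0 l') (leq0n _).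
apply: (@le_trans _ _ (level p A Th Z b 0)).
  by move: h0; rewrite -/b -/t -/m natrD mulrDl; lra.
rewrite /level; under [X in E _ X <= _]funext do rewrite E_cpow0 raise0.
rewrite [leLHS]E_swap; apply: blk_le => // j /andP[bj jb].
apply: cpow_mono; first exact: dist_unif1.
  apply: ltnW; apply: leq_trans jb _; apply: (@leq_trans (4 * b)); first by rewrite addnn -mul2n leq_mul2r orbT.
  by rewrite -blS /bl leq_pmul2r// leq_exp2l.
by move=> U V UV; apply: E_le => // x; apply: g_mono; apply: setUS.
Qed.

End Dichotomy.

(* The bounded set [Z] is covered by a union of random residue classes, a random
   coalition whose number of outcomes does not depend on [n]. *)
Section Hosts.
Variables (R : realFieldType) (n D : nat).
Hypothesis D_gt0 : (0 < D)%N.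
Local Notation S := {set 'I_n}.

Definition residue (c : 'I_D) : S := [set i : 'I_n | (i %% D == c)%N].

Definition residue_law : S -> R := push (fun _ : 'I_D => D%:R^-1) residue.

Lemma dist_residue : dist residue_law.
Proof.
apply: dist_push; split=> [i|]; first by rewrite invr_ge0.
by rewrite sumr_const card_ord -[LHS]mulr_natl divff// pnatr_eq0 -lt0n.
Qed.

Lemma supp_residue : supp residue_law (n %/ D).+1.
Proof.
apply: supp_push => c; rewrite -[leqRHS]card_ord.
have lt (i : 'I_n) : (i %/ D < (n %/ D).+1)%N by rewrite ltnS leq_div2r// ltnW.
rewrite -(card_in_imset (f := fun i : 'I_n => Ordinal (lt i))); first exact: max_card.
move=> i j; rewrite !inE => /eqP ic /eqP jc [] ij; apply/val_inj.
by rewrite /= (divn_eq i D) (divn_eq j D) ij ic jc.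
Qed.

(** Each of the [h] independent random classes contains its own prescribed element of [Z] with
    probability 1/D. *)
Lemma host_prob h (Z : S) : (#|Z| <= h)%N ->
  D%:R^-1 ^+ h <= E (cpow residue_law h) (fun U => (Z \subset U)%:R).
Proof.
have d0 : 0 <= D%:R^-1 :> R by rewrite invr_ge0.
elim: h Z => [|h IH] Z Zh.
  by rewrite E_cpow0; move: Zh; rewrite leqn0 cards_eq0 => /eqP ->; rewrite sub0set.
have dr := dist_residue; have dh := dist_cpow h dr.
have [Z0|[i iZ]] := set_0Vmem Z.
  have -> : (fun U : S => (Z \subset U)%:R) = fun=> 1 :> R.
    by apply/funext => U; rewrite Z0 sub0set.
  rewrite E_cst; last exact: dist_cpow.
  by rewrite exprn_ile1// invf_le1 ?ltr0n// ler1n.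
have Zi : (#|Z :\ i| <= h)%N by move: Zh; rewrite (cardsD1 i) iZ.
rewrite /= E_conv.
apply: (@le_trans _ _ (E residue_law (fun U => (i \in U)%:R * E (cpow residue_law h)
   (fun V => (Z :\ i \subset V)%:R)))); last first.
  apply: E_le => [U|U]; first by case: dr.
  rewrite -EZ; apply: E_le => [V|V]; first by case: dh.
  rewrite -natrM ler_nat mulnb; case: (boolP (i \in U)) => //= iU.
  case: (boolP (Z :\ i \subset V)) => //= ZV; suff -> : Z \subset U :|: V by [].
  rewrite -(setD1K iZ) subUset sub1set inE iU /=.
  exact: subset_trans ZV (subsetUr _ _).
have -> : (fun U : S => (i \in U)%:R * E (cpow residue_law h) (fun V => (Z :\ i \subset V)%:R)) =
   fun U => E (cpow residue_law h) (fun V => (Z :\ i \subset V)%:R) * (i \in U)%:R.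
  by apply/funext => U; rewrite mulrC.
rewrite EZ exprSr; apply: ler_pM; rewrite ?exprn_ge0// ?IH//.
rewrite E_push /E (bigD1 (Ordinal (ltn_pmod i D_gt0)))//= inE eqxx mulr1 lerDl.
by apply: sumr_ge0 => c _; rewrite mulr_ge0.
Qed.

End Hosts.

(** Markov's inequality for [1 - F]. *)
Lemma markov_top (R : realFieldType) (T : finType) (w F : T -> R) (d : R) :
    dist w -> 0 < d -> (forall t, F t <= 1) -> 1 - d / 2 <= E w F ->
  2^-1 <= E w (fun t => ((1 - d <= F t)%R)%:R).
Proof.
move=> dw d0 F1 EF.
suff : E w F <= E w (fun t => (1 - d) + d * ((1 - d <= F t)%R)%:R).
  rewrite ED EZ E_cst// => h.
  suff : d * 2^-1 <= d * E w (fun t => ((1 - d <= F t)%R)%:R) by rewrite ler_pM2l.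
  by lra.
apply: E_le => [t|t]; first by case: dw.
by have := F1 t; case: (leP (1 - d) (F t)) => h1 h2 /=; lra.
Qed.

(** * Explicit constants and their tower bound *)

Definition tower4 (k : nat) : nat := (2 ^ (2 ^ (2 ^ (2 ^ k))))%N.

Section Constants.
Variable kap : nat.
Hypothesis kap16 : (16 <= kap)%N.

(* [pL] scales are tried on each side; [n / pDelta] and [n / pTh] are the smallest
   sizes of [B] and [T], [2 ^ pk] the noise parameter of the variance bound,
   [1 / peta] the influence threshold, [ph] the bound on [#|Z|], and [pD] the
   number of residue classes used to host [Z]. *)
Definition pL := (256 * kap)%N.
Definition pu := (4 ^ pL)%N.
Definition pDelta := (2 * kap * pu)%N.
Definition pTh := (512 * kap * pu * pDelta)%N.
Definition pk := (19 + 1540 * kap)%N.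
Definition peta := (4 ^ (2 ^ (pk + pk + 2)) * (2 ^ pk) ^ 2)%N.
Definition ph := (pL ^ 2 * peta)%N.
Definition pD := (2 * kap * ph)%N.

Let kap_gt0 : (0 < kap)%N. Proof. exact: leq_trans kap16. Qed.
Let kap2 : (kap <= 2 ^ kap)%N. Proof. exact/ltnW/ltn_expl. Qed.

Lemma pu_gt0 : (0 < pu)%N. Proof. by rewrite expn_gt0. Qed.

(** Bounds the first dense term of the variance by the error unit 1/(256 kap) of [one_round]. The
    left side expands to 256 * 512 * 4 * kap^4 * pu^3, whose factors account for the summands 8, 9,
    2, 4 kap and 3 * 512 kap of [pk]. *)
Lemma ThDelta_le : (256 * kap * (pTh * pDelta) <= 2 ^ pk)%N.
Proof.
have uE : pu = (2 ^ (512 * kap))%N by rewrite /pu /pL -[4%N]/(2 ^ 2)%N -expnM; congr expn; lia.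
have e (c d x y : nat) : (c * x * (d * x * y * (2 * x * y) * (2 * x * y)) =
    c * d * 2 * 2 * (x * x * x * x) * y * y * y)%N by ring.
rewrite /pTh /pDelta e.
have f (i j z w : nat) : (2 ^ (i + j + 2 + (z + z + z + z) + w + w + w) =
    2 ^ i * 2 ^ j * 2 * 2 * (2 ^ z * 2 ^ z * 2 ^ z * 2 ^ z) * 2 ^ w * 2 ^ w * 2 ^ w)%N.
  by rewrite !expnD !mulnA.
have -> : pk = (8 + 9 + 2 + (kap + kap + kap + kap) + 512 * kap + 512 * kap + 512 * kap)%N.
  by rewrite /pk; move: kap => z; lia.
rewrite f -uE; have h8 : (256 <= 2 ^ 8)%N by [].
have h9 : (512 <= 2 ^ 9)%N by [].
have h : (kap * kap * kap * kap <= 2 ^ kap * 2 ^ kap * 2 ^ kap * 2 ^ kap)%N by rewrite !leq_mul.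
rewrite !leq_pmul2r ?pu_gt0//; apply: leq_mul h.
by rewrite !leq_pmul2r//; apply: leq_mul h8 h9.
Qed.

Lemma pDelta_gt0 : (0 < pDelta)%N. Proof. by rewrite !muln_gt0 kap_gt0 pu_gt0. Qed.

Lemma pTh_gt1 : (1 < pTh)%N.
Proof.
by rewrite /pTh; have := pDelta_gt0; have := pu_gt0; have := kap_gt0;
  move: kap pu pDelta => a b c; nia.
Qed.

Lemma pTh_le : (2 * pTh <= 2 ^ pk)%N.
Proof.
apply: leq_trans ThDelta_le; apply: leq_mul; last by rewrite leq_pmulr// pDelta_gt0.
by apply: (@leq_trans 256) => //; rewrite leq_pmulr.
Qed.

Lemma Delta_le_pk : (pDelta <= 2 ^ pk)%N.
Proof.
apply: leq_trans ThDelta_le; rewrite mulnA leq_pmull//.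
by rewrite muln_gt0 (ltnW pTh_gt1) andbT muln_gt0 kap_gt0.
Qed.

(** An exponential against a linear function; the inequality fails at 15 and holds from 16 on. *)
Lemma pk_le : (2 * pk + 5 <= 2 ^ kap)%N.
Proof.
have h m : (16 <= m)%N -> (2 * (19 + 1540 * m) + 5 <= 2 ^ m)%N.
  elim: m => // m IH; rewrite leq_eqVlt => /orP[/eqP <-|]; last first.
    rewrite ltnS => m16; have := IH m16; rewrite expnS; move: (2 ^ m)%N => q; lia.
  by rewrite -[16%N]/(4 * 4)%N expnM -[(2 ^ 4)%N]/(4 * 4)%N.
exact: h.
Qed.

Lemma peta_gt0 : (0 < peta)%N. Proof. by rewrite muln_gt0 !expn_gt0. Qed.

Lemma pL_gt0 : (0 < pL)%N. Proof. by rewrite muln_gt0 kap_gt0. Qed.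

Lemma ph_gt0 : (0 < ph)%N.
Proof. by rewrite /ph muln_gt0 peta_gt0 andbT expn_gt0 pL_gt0. Qed.

Lemma pD_gt0 : (0 < pD)%N.
Proof. by rewrite /pD muln_gt0 ph_gt0 andbT muln_gt0 kap_gt0. Qed.

Local Notation M := (2 ^ (pk + pk + 2))%N.

Let M_big : (16 + 2 * kap + 2 * pk <= 2 * M)%N.
Proof.
have : (pk + pk + 2 < M)%N by apply: ltn_expl.
have : (2 * kap + 14 <= pk)%N by rewrite /pk; lia.
by move: pk M kap => a b c; lia.
Qed.

Let ph_le : (ph <= 2 ^ (4 * M))%N.
Proof.
have h8 : (256 <= 2 ^ 8)%N by [].
have hL : (pL <= 2 ^ (8 + kap))%N by rewrite expnD; apply: leq_mul.
apply: (@leq_trans ((2 ^ (8 + kap)) ^ 2 * ((2 ^ 2) ^ M * (2 ^ pk) ^ 2))).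
  by apply: leq_mul => //; rewrite leq_exp2r.
rewrite -!expnM -!expnD leq_exp2l//; have := M_big; move: M pk kap => a b c; lia.
Qed.

Let pD_le : (pD <= 2 ^ (5 * M))%N.
Proof.
apply: (@leq_trans (2 * 2 ^ kap * 2 ^ (4 * M))%N); first by rewrite !leq_mul.
rewrite -expnS -expnD leq_exp2l//; have := M_big.
have : (pk + pk + 2 < M)%N by apply: ltn_expl.
have : (2 * kap + 14 <= pk)%N by rewrite /pk; lia.
by move: M pk kap => a b c; lia.
Qed.

(** The layers: [pk] is linear in [kap], [M] is 2^(2 pk + 2), [ph] and [pD] are at most 2^(4M) and
    2^(5M), so the left side is at most 2^(2^(6M)), and 6M <= 2^(2 pk + 5) <= 2^(2^kap). These are
    the four exponentials of a round. *)
Lemma pD_tower : (8 * kap * pD ^ ph <= tower4 kap)%N.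
Proof.
have M1 : (pk + pk + 2 < M)%N by apply: ltn_expl.
have pk2 : (2 * kap + 14 <= pk)%N by rewrite /pk; lia.
have hD : (pD ^ ph <= 2 ^ (5 * M * 2 ^ (4 * M)))%N.
  rewrite expnM; apply: (@leq_trans ((2 ^ (5 * M)) ^ ph)).
    by rewrite leq_exp2r// ph_gt0.
  by apply: leq_pexp2l => //; rewrite expn_gt0.
apply: (@leq_trans (2 ^ 3 * 2 ^ kap * 2 ^ (5 * M * 2 ^ (4 * M)))%N).
  by apply: leq_mul hD; apply: leq_mul.
rewrite -!expnD /tower4 leq_exp2l//; apply: (@leq_trans (2 ^ (6 * M))).
  have h2 : (M < 2 ^ M)%N by apply: ltn_expl.
  have -> : (2 ^ (6 * M) = 2 ^ M * 2 ^ M * 2 ^ (4 * M))%N by rewrite -!expnD; congr expn; move: M => a; lia.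
  have : (0 < 2 ^ (4 * M))%N by rewrite expn_gt0.
  have aux a b c d f : (d + d + 2 < a)%N -> (2 * f + 14 <= d)%N -> (a < b)%N -> (0 < c)%N ->
      (3 + f + 5 * a * c <= b * b * c)%N.
    move=> *; apply: (@leq_trans ((3 + f + 5 * a) * c)); first by nia.
    by rewrite leq_mul2r; apply/orP; right; nia.
  by move=> h4; apply: (aux M (2 ^ M)%N (2 ^ (4 * M))%N pk kap M1 pk2 h2 h4).
rewrite leq_exp2l//; apply: leq_trans (_ : 2 ^ (2 * pk + 5) <= _)%N; last by rewrite leq_exp2l ?pk_le.
have -> : (2 ^ (2 * pk + 5) = 8 * M)%N.
  by rewrite -[8%N]/(2 ^ 3)%N -expnD; congr expn; move: pk => a; lia.
by rewrite leq_mul2r orbT.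
Qed.

Lemma pD_le_tower : (pD <= tower4 kap)%N.
Proof.
apply: leq_trans pD_tower; apply: (@leq_trans (pD ^ ph)).
  by rewrite -{1}[pD]expn1 leq_pexp2l ?pD_gt0 ?ph_gt0.
by rewrite leq_pmull// muln_gt0 kap_gt0.
Qed.

Lemma pk_le_tower : (2 ^ pk <= tower4 kap)%N.
Proof.
apply: leq_trans pD_le_tower; rewrite /pD /ph /peta.
apply: (@leq_trans ((2 ^ pk) ^ 2)); first by rewrite -expnM leq_exp2l// leq_pmulr.
have h1 : (0 < 4 ^ M)%N by rewrite expn_gt0.
have h2 : (0 < pL ^ 2)%N by rewrite expn_gt0 pL_gt0.
have h3 := kap_gt0.
by rewrite mulnA mulnA leq_pmull// muln_gt0 h1 andbT muln_gt0 h2 andbT muln_gt0 h3.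
Qed.

End Constants.

Lemma divS_ler (R : realFieldType) (n d : nat) : (0 < d)%N ->
  n%:R / (n %/ d).+1%:R <= d%:R :> R.
Proof. by move=> d0; rewrite ler_pdivrMr ?ltr0n// -natrM ler_nat mulnC ltnW// ltn_ceil. Qed.

Lemma divS_ler' (R : realFieldType) (n d : nat) : (0 < d)%N ->
  n%:R / d%:R <= (n %/ d).+1%:R :> R.
Proof. by move=> d0; rewrite ler_pdivrMr ?ltr0n// -natrM ler_nat ltnW// ltn_ceil. Qed.

Lemma divS_leq2 n d : (d <= n)%N -> ((n %/ d).+1 * d <= 2 * n)%N.
Proof. by move=> dn; rewrite mulSn mul2n -addnn leq_add// leq_divM. Qed.

(** * One round with the constants fixed *)

Section OneRound.
Variables (R : realFieldType) (n : nat) (p : 'I_n -> bool -> R) (kap : nat).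
Hypothesis p_ge0 : forall i b, 0 <= p i b.
Hypothesis p_sum1 : forall i, p i true + p i false = 1.
Hypotheses (kap16 : (16 <= kap)%N) (n_big : (tower4 kap <= n)%N).
Local Notation X := (bits 'I_n).
Local Notation S := {set 'I_n}.
Local Notation Ex := (E (wt p)).

Local Notation Th := (pTh kap).
Local Notation L := (pL kap).
Local Notation Dl := (pDelta kap).
Local Notation k := (pk kap).
Local Notation h := (ph kap).
Local Notation D := (pD kap).
Local Notation t0 := (n %/ Th).+1.
Local Notation b0 := (n %/ Dl).+1.

Let kap_gt0 : (0 < kap)%N. Proof. exact: leq_trans kap16. Qed.
Let n_gt0 : (0 < n)%N. Proof. by apply: leq_trans n_big; rewrite expn_gt0. Qed.
Let Th_n : (Th <= n)%N.
Proof.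
apply: leq_trans n_big; apply: leq_trans (pk_le_tower kap16).
by apply: leq_trans (pTh_le kap16); rewrite leq_pmull.
Qed.
Let Dl_n : (Dl <= n)%N.
Proof. exact: leq_trans (leq_trans (Delta_le_pk kap16) (pk_le_tower kap16)) n_big. Qed.
Let D_n : (D <= n)%N. Proof. exact: leq_trans (pD_le_tower kap16) n_big. Qed.
Let Th0 : (0 < Th)%N. Proof. exact/ltnW/pTh_gt1. Qed.
Let Dl0 : (0 < Dl)%N. Proof. exact: pDelta_gt0. Qed.
Let D0 : (0 < D)%N. Proof. exact: pD_gt0. Qed.

(** The input raised at the top scale, under which rarity of [A] is measured. It does not depend on
    [A], so the induction on rounds can average over it before [A] is known. *)
Definition final_law : X -> R :=
  push (fun z : X * S => wt p z.1 * cpow (sT p Th) (4 ^ L * t0) z.2)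
       (fun z => raise p Th z.1 z.2).

Lemma E_final H : E final_law H =
  Ex (fun x => E (cpow (sT p Th) (4 ^ L * t0)) (fun T => H (raise p Th x T))).
Proof.
rewrite E_push /E -(pair_bigA _ (fun x T => wt p x * cpow (sT p Th) (4 ^ L * t0) T *
   H (raise p Th x T))) /=.
by apply: eq_bigr => x _; rewrite mulr_sumr; apply: eq_bigr => T _; rewrite mulrA.
Qed.

Lemma dist_final : dist final_law.
Proof.
have [w0 w1] := wt_dist p_ge0 p_sum1.
have [c0 c1] : dist (cpow (sT p Th) (4 ^ L * t0)) by apply/dist_cpow/dist_sT => //; apply: pTh_gt1.
apply: dist_push; split=> [[x T]|]; first by rewrite mulr_ge0.
rewrite -(pair_bigA _ (fun x T => wt p x * cpow (sT p Th) (4 ^ L * t0) T)) /= -[RHS]w1.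
by apply: eq_bigr => x _; rewrite -mulr_sumr c1 mulr1.
Qed.

(** Uniform players form the random coalition; the residue classes are there to cover the unknown
    [Z]. *)
Definition coalition_law : S -> R :=
  conv (cpow (@unif1 R n) (4 ^ L * b0)) (cpow (@residue_law R n D) h).

Lemma dist_coalition : dist coalition_law.
Proof.
by apply: dist_conv; apply: dist_cpow; [apply: dist_unif1 | apply: dist_residue].
Qed.

Definition coalition_size : nat := (4 ^ L * b0 * 1 + h * (n %/ D).+1)%N.

Lemma supp_coalition : supp coalition_law coalition_size.
Proof.
apply: supp_conv; apply: supp_cpow; last exact: supp_residue.
by apply: supp_push => i; rewrite cards1.
Qed.

(** The factor [2 * kap] in [pDelta] and in [pD] limits each of the two parts to n/kap players, the
    2 absorbing the rounding up. *)
Lemma coalition_size_le : (kap * coalition_size <= 2 * n)%N.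
Proof.
have h1 := divS_leq2 Dl_n; have h2 := divS_leq2 D_n.
have e1 : (2 * (kap * (4 ^ L * b0)) = b0 * Dl)%N.
  by move: b0 => v; rewrite /pDelta /pu; move: (4 ^ L)%N => u; ring.
have e2 : (2 * (kap * (h * (n %/ D).+1)) = (n %/ D).+1 * D)%N.
  by move: (n %/ D).+1 => u; rewrite /pD; move: h => v; ring.
rewrite /coalition_size muln1 mulnDr -(leq_pmul2l (isT : 0 < 2)%N) mulnDr e1 e2.
by rewrite mulnA -[(2 * 2)%N]/(2 + 2)%N mulnDl leq_add.
Qed.

(** The hypothesis excludes the rare case of [dichotomy]. In the other case at least half of the
    sets [B], joined with [Z], succeed with probability 1 - 1/kap, and an independent host covers
    [Z] with probability at least D^-h. *)
Lemma one_round (A : pred X) :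
    (4 * kap%:R)^-1 <= E final_law (fun x => (A x)%:R) ->
  4 * kap%:R / (tower4 kap)%:R <=
  E coalition_law (fun B => ((1 - kap%:R^-1 <= Ex (g R A B))%R)%:R).
Proof.
move=> hA; pose e : R := L%:R^-1.
have L0 : (0 < L)%N by apply: pL_gt0.
have kR : 0 < kap%:R :> R by rewrite ltr0n.
have LR : 0 < L%:R :> R by rewrite ltr0n.
have eE : e = (256 * kap%:R)^-1 by rewrite /e /pL natrM.
have eta0 : 0 < (peta kap)%:R :> R by rewrite ltr0n peta_gt0.
(* In units of [e] the thresholds 1/(4 kap) and 1/(2 kap) are 64 and 128, both above the 20 of
   [dichotomy]. *)
have kk : kap%:R^-1 = 256 * e by rewrite eE; field; lra.
have e0 : 0 < e by rewrite invr_gt0.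
have lt_e : 20 * e < (4 * kap%:R)^-1 by rewrite invfM kk; lra.
have le_e : 1 - kap%:R^-1 / 2 <= 1 - 20 * e by rewrite kk; lra.
have Q0 : 0 < (2 ^ k)%:R :> R by rewrite ltr0n expn_gt0.
have ThDl : (2 ^ k)%:R^-1 * (Th%:R * Dl%:R) <= e.
  rewrite eE mulrC ler_pdivrMr// [leRHS]mulrC ler_pdivlMr ?mulr_gt0// -!natrM ler_nat mulnC.
  exact: ThDelta_le.
have ThQ : (2 ^ k)%:R^-1 * Th%:R <= 1 :> R.
  rewrite mulrC ler_pdivrMr// mul1r ler_nat.
  by apply: leq_trans (pTh_le kap16); rewrite leq_pmull.
have s_e : (4 ^ L * t0)%:R / b0%:R <= e.
  rewrite ler_pdivrMr ?ltr0n// [leRHS]mulrC ler_pdivlMr// -natrM ler_nat.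
  have h1 := divS_leq2 Th_n; have h2 : (n < b0 * Dl)%N by apply: ltn_ceil.
  have e1 : (t0 * Th = 2 * Dl * (4 ^ L * t0 * L))%N.
    move: t0 => u; rewrite /pTh /pu; move: Dl (4 ^ L)%N => v w; rewrite /pL.
    by rewrite -[512%N]/(2 * 256)%N; move: 256%N => c; ring.
  rewrite -(leq_pmul2l (isT : 0 < 2)%N) -(leq_pmul2l Dl0) mulnA [(Dl * 2)%N]mulnC -e1.
  apply: leq_trans h1 _; rewrite mulnCA leq_mul2l /= mulnC; exact: ltnW.
have eta_e : 4 ^+ (2 ^ (k + k + 2))%N * (Th%:R ^+ 2 * (peta kap)%:R^-1 * Dl%:R) <= e.
  have -> : 4 ^+ (2 ^ (k + k + 2))%N * (Th%:R ^+ 2 * (peta kap)%:R^-1 * Dl%:R) =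
    ((2 ^ k)%:R^-1 * Th%:R) * ((2 ^ k)%:R^-1 * (Th%:R * Dl%:R)) :> R.
    have -> : (peta kap)%:R = 4 ^+ (2 ^ (k + k + 2))%N * (2 ^ k)%:R ^+ 2 :> R.
      by rewrite /peta natrM; congr (_ * _); apply: natrX.
    have c0 : 4 ^+ (2 ^ (k + k + 2))%N != 0 :> R by apply: expf_neq0; rewrite pnatr_eq0.
    move: c0; set c := 4 ^+ _ => c0; move: Q0; set q := (2 ^ k)%:R => q0.
    move: Th%:R Dl%:R c c0 q q0 => u v c c0 q q0.
    by field; rewrite c0 gt_eqF.
  apply: le_trans ThDl; apply: ler_piMl => //.
  by rewrite mulr_ge0 ?invr_ge0// mulr_ge0.
have h_eta : (L ^ 2)%:R <= h%:R * (peta kap)%:R^-1 :> R.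
  by rewrite /ph natrM mulfK// gt_eqF.
have [Z Zh] := dichotomy p_ge0 p_sum1 n_gt0 A (pTh_gt1 kap16) L0 (ltn0Sn _) (ltn0Sn _)
   (pTh_le kap16) (eta := (peta kap)%:R^-1) (e := e) (Delta := Dl%:R) 
   (ltac:(by rewrite invr_gt0)) h_eta
   (divS_ler R n Dl0) (divS_ler' R n Th0) (lexx _) s_e ThDl eta_e.
case=> [lo|hi].
  by move: hA; rewrite leNgt E_final (le_lt_trans lo lt_e).
have hm : 1 - kap%:R^-1 / 2 <= E (cpow (@unif1 R n) (4 ^ L * b0)) (fun B => Ex (g R A (Z :|: B))).
  exact: le_trans le_e hi.
have du : dist (cpow (@unif1 R n) (4 ^ L * b0)) by apply/dist_cpow/dist_unif1.
have dr : dist (cpow (@residue_law R n D) h) by apply/dist_cpow/dist_residue.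
have kV : 0 < kap%:R^-1 :> R by rewrite invr_gt0.
have dwt : dist (wt p) by apply: wt_dist.
have half := markov_top du kV (fun B => E_lec dwt (@g_le1 R n A (Z :|: B))) hm.
have hostZ := @host_prob R n D D0 h Z Zh.
have Dh0 : 0 <= D%:R^-1 ^+ h :> R by rewrite exprn_ge0 ?invr_ge0.
apply: (@le_trans _ _ (2^-1 * D%:R^-1 ^+ h)).
  rewrite ler_pdivrMr ?ltr0n ?expn_gt0// exprVn -invfM [leRHS]mulrC ler_pdivlMr; last first.
    by rewrite mulr_gt0// exprn_gt0// ltr0n.
  rewrite -natrX -!natrM ler_nat; apply: leq_trans (pD_tower kap16).
  by rewrite mulnA [(4 * kap * 2)%N]mulnAC.
apply: le_trans (ler_pM _ Dh0 half hostZ) _; first by rewrite invr_ge0.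
rewrite /coalition_law E_conv E_mul; apply: E_le => [B|B]; first by case: du.
apply: E_le => [U|U]; first by case: dr.
rewrite -natrM ler_nat mulnb.
case: (boolP (Z \subset U)) => ZU; rewrite ?andbF// andbT.
case: (boolP (1 - kap%:R^-1 <= Ex (g R A (Z :|: B)))) => // hB.
suff -> : 1 - kap%:R^-1 <= Ex (g R A (B :|: U)) by [].
apply: le_trans hB _; apply: E_le => [x|x]; first by case: dwt.
by apply: g_mono; rewrite subUset subsetUl (subset_trans ZU (subsetUr _ _)).
Qed.

End OneRound.

(** * Many rounds *)

Section Rounds.
Variables (R : realType) (n : nat).
Local Notation X := (bits 'I_n).
Local Notation S := {set 'I_n}.
Implicit Types (B J : S) (F : seq X -> bool) (m : fdist R X) (ms : seq (fdist R X)).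

Lemma fdist_dist m : dist m.
Proof. by split; [exact: pmf_ge0 | exact: pmf_sum1]. Qed.

Definition marginal m (i : 'I_n) (b : bool) : R := Pr m (fun x => x i == b).

Lemma marginal_ge0 m i b : 0 <= marginal m i b.
Proof. by apply: sumr_ge0 => x _; apply: pmf_ge0. Qed.

Lemma marginal_sum1 m i : marginal m i true + marginal m i false = 1.
Proof.
rewrite -(pmf_sum1 m) /marginal /Pr [RHS](bigID (fun x : X => x i)) /=.
by congr (_ + _); apply: eq_bigl => x; case: (x i).
Qed.

Lemma product_wt m x : product_measure m -> wt (marginal m) x = m x.
Proof.
move=> /(_ (fun i => pred1 (x i))); rewrite {1}/Pr (big_pred1 x) => [e|y]; first exact: esym e.
apply/forallP/eqP => [h|-> i]; last by rewrite inE eqxx.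
by apply/ffunP => i; apply/eqP; apply: h.
Qed.

Lemma E_restrict B m (G : bits (good B) -> R) :
  E (@restricted_measure R n B m) G = E m (fun x => G (restrict B x)).
Proof.
have -> : @restricted_measure R n B m = push m (@restrict n B).
  apply/funext => a; rewrite /restricted_measure /Pr /push big_mkcond.
  by apply: eq_bigr => x _; case: eqP; rewrite ?mulr1 ?mulr0.
exact: E_push.
Qed.

Definition badpart B (y : X) : bits (bad B) := [ffun i : bad B => y (val i)].

Lemma combine_in B (a : bits (good B)) (c : bits (bad B)) i (iB : i \in B) :
  combine a c i = c (exist _ i iB).
Proof.
rewrite ffunE; move: (boolP (i \in B)) => z; destruct z as [iB'|iB'].
  by congr (c _); apply: val_inj.
by case: (negP iB').
Qed.

Lemma combine_out B (a : bits (good B)) (c : bits (bad B)) i (iB : i \notin B) :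
  combine a c i = a (exist _ i iB).
Proof.
rewrite ffunE; move: (boolP (i \in B)) => z; destruct z as [iB'|iB'].
  by case: (negP iB).
by congr (a _); apply: val_inj.
Qed.

Lemma combineE B (x y : X) : (forall i, i \notin B -> y i = x i) ->
  combine (restrict B x) (badpart B y) = y.
Proof.
move=> h; apply/ffunP => i; have [iB|iB] := boolP (i \in B).
  by rewrite (combine_in _ _ iB) ffunE.
by rewrite (combine_out _ _ iB) ffunE /= h.
Qed.

Lemma combine_off B (x : X) (c : bits (bad B)) i : i \notin B -> combine (restrict B x) c i = x i.
Proof. by move=> iB; rewrite (combine_out _ _ iB) ffunE. Qed.

Lemma combine_badpart B (a : bits (good B)) (c : bits (bad B)) :
  combine a (badpart B (combine a c)) = combine a c.
Proof.
apply/ffunP => i; have [iB|iB] := boolP (i \in B).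
  by rewrite (combine_in _ _ iB) ffunE.
by rewrite !(combine_out _ _ iB).
Qed.

(** The value by backward induction: the honest bits of a round are averaged, then the coalition
    takes its best reply. The default 0 of the maximum is harmless because values are
    nonnegative. *)
Fixpoint val_of ms B F : R :=
  if ms is m :: ms' then
    E (@restricted_measure R n B m) (fun a =>
      \big[Num.max/0]_(c : bits (bad B)) val_of ms' B (fun s => F (combine a c :: s)))
  else (F [::])%:R.

Lemma restricted_ge0 B m a : 0 <= @restricted_measure R n B m a.
Proof. by apply: sumr_ge0 => x _; apply: pmf_ge0. Qed.

Lemma bigmax_ge0 (T : finType) (G : T -> R) : 0 <= \big[Num.max/0]_t G t.
Proof. by elim/big_rec: _ => // t x _ x0; rewrite le_max x0 orbT. Qed.

Lemma val_ge0 ms B F : 0 <= val_of ms B F.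
Proof.
case: ms => [|m ms] /=; first by [].
by apply: E_ge0 => a; [exact: restricted_ge0 | exact: bigmax_ge0].
Qed.

(** The larger coalition imitates the smaller one, its extra members playing the bits that they
    would have drawn honestly. *)
Lemma val_mono ms B B' F : B \subset B' -> val_of ms B F <= val_of ms B' F.
Proof.
move=> BB; elim: ms F => [|m ms IH] F //=.
rewrite !E_restrict; apply: E_le => [x|x]; first exact: pmf_ge0.
apply: bigmax_le => [|c _]; first exact: bigmax_ge0.
apply: le_trans (IH _) _.
rewrite -(@combineE B' x (combine (restrict B x) c)).
  by apply: (le_bigmax _ (fun c => val_of ms B' (fun s => F (combine (restrict B' x) c :: s)))).
by move=> i iB; rewrite combine_off//; apply: contra iB; apply: (subsetP BB).
Qed.

(** The coalition steers the first string into [A] whenever [A] is reachable, and from there the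
    value is at least [v]. *)
Lemma val_round m ms B F (A : pred X) (v : R) : 0 <= v ->
    (forall y, A y -> v <= val_of ms B (fun s => F (y :: s))) ->
  E m (g R A B) * v <= val_of (m :: ms) B F.
Proof.
move=> v0 Av; rewrite /= E_restrict mulrC -EZ; apply: E_le => [x|x]; first exact: pmf_ge0.
rewrite /g; case: (boolP (reach A B x)) => [/reachP[y Ay yx]|_]; last by rewrite mulr0 bigmax_ge0.
rewrite mulr1; apply: le_trans (Av _ Ay) _; rewrite -(combineE yx).
by apply: (le_bigmax _ (fun c => val_of ms B (fun s => F (combine (restrict B x) c :: s)))).
Qed.

Variable kap0 : nat.
Hypothesis kap0_16 : (16 <= kap0)%N.

Lemma leq_tower4 k : (k <= tower4 k)%N.
Proof.
have h j : (j <= 2 ^ j)%N by apply/ltnW/ltn_expl.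
exact: leq_trans (leq_trans (leq_trans (h k) (h _)) (h _)) (h _).
Qed.

Local Notation kap r := (iter r tower4 kap0).

Lemma kap0_le r : (kap0 <= kap r)%N.
Proof. by elim: r => //= r IH; apply: leq_trans IH (leq_tower4 _). Qed.

(** Every round is allowed a loss of 1/kap0. *)
Definition controls ms F J : bool :=
  [exists b : bool, 1 - (size ms)%:R / kap0%:R <= val_of ms J (fun s => F s == b)].

(** The law [w] is chosen before [F], so the induction hypothesis applies at once to all protocols
    left over by the possible first strings. The new law is the union of the old one and an
    independent coalition for the first round. *)
Lemma rounds ms :
  foldr (fun m P => product_measure m /\ P) True ms -> (kap (size ms) <= n)%N ->
  exists (w : S -> R) (s : nat),
    [/\ dist w, supp w s, (kap0 * s <= size ms * (2 * n))%N &
      forall F, (kap (size ms))%:R^-1 <= E w (fun J => (controls ms F J)%:R)].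
Proof.
elim: ms => [|m ms IH] /=.
  move=> _ _; exists (cpow (fun=> 0) 0), 0%N; split.
  - exact: dist_cpow0.
  - by move=> U /=; have [->|_] := eqVneq U set0; rewrite ?cards0 ?eqxx.
  - by rewrite muln0.
  move=> F; have -> : (fun J => (controls [::] F J)%:R) = fun=> 1 :> R.
    apply/funext => J; rewrite /controls; suff -> : [exists b, 1 - (size (@nil (fdist R X)))%:R / kap0%:R <=
       val_of [::] J (fun s => F s == b)] by [].
    by apply/existsP; exists (F [::]); rewrite /= eqxx mul0r subr0.
  rewrite E_cst; last exact: dist_cpow0.
  by rewrite invf_le1 ?ltr0n ?ler1n; apply: leq_trans kap0_16.
move=> [pm pms] kn; have kn' : (kap (size ms) <= n)%N by apply: leq_trans (leq_tower4 _) kn.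
have [w [s [dw sw ssize hw]]] := IH pms kn'.
set K := kap (size ms) in kn kn' hw *.
have K16 : (16 <= K)%N by apply: leq_trans kap0_16 (kap0_le _).
have kap0K : (kap0 <= K)%N by apply: kap0_le.
have p0 := marginal_ge0 m; have p1 := marginal_sum1 m.
have mE : wt (marginal m) = m by apply/funext => x; apply: product_wt.
pose cw := @coalition_law R n K.
have dc : dist cw by apply: dist_coalition.
exists (conv w cw), (s + coalition_size n K)%N; split.
- exact: dist_conv.
- exact/supp_conv/supp_coalition.
- rewrite mulnDr mulSn addnC leq_add//; apply: leq_trans (coalition_size_le K16 kn).
  by rewrite leq_mul2r kap0K orbT.
move=> F; set N := (size ms).
pose A J b : pred X := fun y => 1 - N%:R / kap0%:R <= val_of ms J (fun s => F (y :: s) == b).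
pose fin := final_law (marginal m) K.
have df : dist fin by apply: dist_final.
pose h J b := E fin (fun y => (A J b y)%:R).
pose big J : bool := [exists b : bool, (4 * K%:R)^-1 <= h J b].
have KR : 0 < K%:R :> R by rewrite ltr0n; apply: leq_trans K16.
have w0 U : 0 <= w U by case: dw.
(* For every [y], [J] controls the rest with probability at least 1/K, so [h J true + h J false]
   averages at least 1/K. The sum is at most 2, and below 1/(2K) unless [J] is big; so big [J] have
   weight at least 1/(4K). *)
have hbig : (4 * K%:R)^-1 <= E w (fun J => (big J)%:R).
  have h1 : K%:R^-1 <= E w (fun J => h J true + h J false).
    have -> : E w (fun J => h J true + h J false) =
        E fin (fun y => E w (fun J => (A J true y)%:R + (A J false y)%:R)).
      by rewrite E_swap; congr E; apply/funext => J; rewrite -ED.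
    rewrite -[leLHS](E_cst _ df); apply: E_le => [y|y]; first by case: df.
    apply: le_trans (hw (fun s => F (y :: s))) _; apply: E_le => // J.
    rewrite /controls; case: existsP => [[b hb]|_]; last by rewrite addr_ge0.
    have Ab : A J b y := hb.
    by case: b Ab {hb} => ->; rewrite ?lerDl ?lerDr.
  have h2 : E w (fun J => h J true + h J false) <= E w (fun J => 2 * (big J)%:R + (2 * K%:R)^-1).
    apply: E_le => // J; rewrite /big; case: existsP => [_|nb].
      have hle1 b : h J b <= 1 by apply: E_lec => // y; rewrite lern1; case: (A J b y).
      have := hle1 true; have := hle1 false; have : 0 <= (2 * K%:R)^-1 :> R by rewrite invr_ge0 mulr_ge0// ltW.
      by rewrite mulr1; lra.
    have hlt b : h J b < (4 * K%:R)^-1 by rewrite ltNge; apply/negP => hb; apply: nb; exists b.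
    have := hlt true; have := hlt false.
    by rewrite mulr0 add0r !invfM; lra.
  move: (le_trans h1 h2); rewrite E_lin E_cst// !invfM; lra.
have K'0 : 0 < (tower4 K)%:R :> R by rewrite ltr0n expn_gt0.
have -> : (tower4 K)%:R^-1 = (4 * K%:R)^-1 * (4 * K%:R / (tower4 K)%:R) :> R.
  by rewrite mulrA mulVf ?mul1r// gt_eqF// mulr_gt0.
have r0 : 0 <= 4 * K%:R / (tower4 K)%:R :> R by rewrite divr_ge0// mulr_ge0// ltW.
apply: le_trans (ler_wpM2r r0 hbig) _.
rewrite mulrC -EZ E_conv; apply: E_le => // J.
have cw0 U : 0 <= cw U by case: dc.
rewrite /big; case: existsP => [[b hb]|_]; last first.
  by rewrite mulr0; apply: E_ge0.
rewrite mulr1; apply: le_trans (one_round p0 p1 K16 kn hb) _.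
apply: E_le => // B; rewrite mE.
case: (boolP (1 - K%:R^-1 <= E m (g R (A J b) B))) => // hB.
suff -> : controls (m :: ms) F (J :|: B) by [].
apply/existsP; exists b.
have k0R : 0 < kap0%:R :> R by rewrite ltr0n; apply: leq_trans kap0_16.
have KK : K%:R^-1 <= kap0%:R^-1 :> R by rewrite lef_pV2 ?posrE ?ler_nat.
have Ki0 : 0 < K%:R^-1 :> R by rewrite invr_gt0.
have -> : (size (m :: ms))%:R / kap0%:R = N%:R / kap0%:R + kap0%:R^-1 :> R.
  by rewrite /= -natr1 mulrDl mul1r.
pose v : R := 1 - N%:R / kap0%:R.
have Nk0 : 0 <= N%:R / kap0%:R :> R by rewrite divr_ge0.
have [v0|v0] := leP 0 v; last first.
  apply: le_trans (val_ge0 _ _ _).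
  have i0 : 0 < kap0%:R^-1 :> R by rewrite invr_gt0.
  by move: v0; rewrite /v; lra.
have := @val_round m ms (J :|: B) (fun s => F s == b) (A J b) v v0.
have Av y : A J b y -> v <= val_of ms (J :|: B) (fun s => F (y :: s) == b).
  by move=> /le_trans; apply; apply: val_mono; apply: subsetUl.
move=> /(_ Av); apply: le_trans.
have gm : E m (g R (A J b) B) <= E m (g R (A J b) (J :|: B)).
  by apply: E_le => [x|x]; [exact: pmf_ge0 | apply/g_mono/subsetUr].
have : (1 - K%:R^-1) * v <= E m (g R (A J b) (J :|: B)) * v.
  by apply: ler_wpM2r => //; apply: le_trans gm.
apply: le_trans; rewrite mulrBl mul1r.
have v1 : v <= 1 by rewrite /v; lra.
have : K%:R^-1 * v <= K%:R^-1 by rewrite ler_piMr ?(ltW Ki0).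
by rewrite /v; lra.
Qed.

End Rounds.

(** * From game values to strategies *)

Section Strategies.
Variables (R : realType) (n : nat) (B : {set 'I_n}).
Local Notation X := (bits 'I_n).
Local Notation G := (bits (good B)).
Implicit Types (F : seq X -> bool) (ms : seq (fdist R X)) (s : seq G).

Let x0 : X := [ffun=> true].
Let a0 : G := [ffun=> true].
Let c0 : bits (bad B) := [ffun=> true].

Definition respond ms F (a : G) : bits (bad B) :=
  [arg max_(c > c0) val_of ms B (fun t => F (combine a c :: t))]%O.

Lemma respondE ms F a :
  \big[Num.max/0]_(c : bits (bad B)) val_of ms B (fun t => F (combine a c :: t)) =
  val_of ms B (fun t => F (combine a (respond ms F a) :: t)).
Proof. by apply: bigmax_eq_arg => // c _; apply: val_ge0. Qed.

Fixpoint play ms F s : seq X :=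
  if ms is m :: ms' then
    if s is a :: s' then
      let y := combine a (respond ms' F a) in y :: play ms' (fun t => F (y :: t)) s'
    else [::]
  else [::].

(** Replies depend only on the honest strings seen so far; this is what allows a [strategy] to
    realize [play]. *)
Lemma play_take ms F s k : play ms F (take k s) = take k (play ms F s).
Proof.
by elim: ms F s k => [|m ms IH] F [|a s] [|k] //=; rewrite IH.
Qed.

Lemma play_nth ms F s k : size ms = size s -> (k < size s)%N ->
  exists c, nth x0 (play ms F s) k = combine (nth a0 s k) c.
Proof.
elim: ms F s k => [|m ms IH] F [|a s] [|k] //= => [_ _|[e] ks].
  by exists (respond ms F a).
exact: IH.
Qed.

Lemma big_ffunS r (H : {ffun 'I_r.+1 -> G} -> R) :
  \sum_a H a = \sum_(x : G) \sum_(a : {ffun 'I_r -> G})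
    H [ffun i => if unlift ord0 i is Some j then a j else x].
Proof.
rewrite pair_bigA /=.
pose h (z : G * {ffun 'I_r -> G}) : {ffun 'I_r.+1 -> G} :=
  [ffun i => if unlift ord0 i is Some j then z.2 j else z.1].
rewrite (reindex h) //=; apply: onW_bij.
exists (fun a : {ffun 'I_r.+1 -> G} => (a ord0, [ffun j => a (lift ord0 j)])) => [[x a]|a].
  congr (_, _); first by rewrite ffunE unlift_none.
  by apply/ffunP => j; rewrite !ffunE liftK.
by apply/ffunP => i; rewrite !ffunE; case: unliftP => [j ->|->] //=; rewrite ffunE.
Qed.

(** The recursion unfolds to the probability that maximal replies lead to [F]; [big_ffunS] splits
    off the first round. *)
Lemma val_sum r (mu : 'I_r -> fdist R X) F :
  val_of [seq mu i | i <- enum 'I_r] B F =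
  \sum_(a : {ffun 'I_r -> G})
    (F (play [seq mu i | i <- enum 'I_r] F [seq a i | i <- enum 'I_r]))%:R *
    \prod_i restricted_measure (mu i) (a i).
Proof.
elim: r mu F => [|r IH] mu F.
  have -> : enum 'I_0 = [::] by apply/size0nil; rewrite size_enum_ord.
  rewrite (big_pred1 (finfun (fun _ : 'I_0 => a0))) /=; last first.
    by move=> a; symmetry; apply/eqP/ffunP => -[].
  by rewrite big_ord0 mulr1.
rewrite enum_ordSl /= -map_comp big_ffunS; apply: eq_bigr => x _.
rewrite respondE (IH (mu \o lift ord0)) mulr_sumr; apply: eq_bigr => a _.
rewrite ffunE unlift_none -map_comp.
have -> : [seq ([ffun i => if unlift ord0 i is Some j then a j else x] \o lift ord0) i |
    i <- enum 'I_r] = [seq a i | i <- enum 'I_r].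
  by apply: eq_map => i; rewrite /= ffunE liftK.
rewrite big_ord_recl ffunE unlift_none mulrCA; congr (_ * (_ * _)).
by apply: eq_bigr => i _; rewrite ffunE liftK.
Qed.

Variables (r : nat) (mu : 'I_r -> fdist R X) (f : protocol n r) (b : bool).

Definition output (t : seq X) : bool := f [ffun i : 'I_r => nth x0 t i].

Let mus := [seq mu i | i <- enum 'I_r].
Let F t := output t == b.

(** Replays the game on the history and keeps the coalition's bits of string [i], the last one that
    the [i.+1] strings seen determine. *)
Definition best_strategy : strategy r B :=
  fun i h => badpart B (nth x0 (play mus F [seq h j | j <- enum 'I_i.+1]) i).

Lemma history_take (a : {ffun 'I_r -> G}) (i : 'I_r) :
  [seq history a i j | j <- enum 'I_i.+1] = take i.+1 [seq a j | j <- enum 'I_r].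
Proof.
have sz : size (take i.+1 [seq a j | j <- enum 'I_r]) = i.+1.
  by rewrite size_takel// size_map size_enum_ord.
apply: (@eq_from_nth _ a0) => [|k]; first by rewrite sz size_map size_enum_ord.
rewrite size_map size_enum_ord => ki; have kr : (k < r)%N := leq_trans ki (ltn_ord i).
rewrite nth_take// (nth_map ord0) ?size_enum_ord// (nth_map i) ?size_enum_ord// ffunE.
by congr (a _); apply: val_inj; rewrite /= !nth_enum_ord.
Qed.

Lemma transcript_play (a : {ffun 'I_r -> G}) :
  transcript best_strategy a =
  [ffun i : 'I_r => nth x0 (play mus F [seq a j | j <- enum 'I_r]) i].
Proof.
apply/ffunP => i; rewrite !ffunE /best_strategy history_take play_take nth_take//.
have sa : size [seq a j | j <- enum 'I_r] = r by rewrite size_map size_enum_ord.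
have sm : size mus = r by rewrite size_map size_enum_ord.
have [||c ->] := @play_nth mus F [seq a j | j <- enum 'I_r] i; rewrite ?sa//.
rewrite (nth_map i) ?size_enum_ord// nth_ord_enum.
exact: combine_badpart.
Qed.

(** Required for the supremum to dominate its members; the products of restricted measures sum to
    1. *)
Lemma influence_bounded : has_ubound (range (@influence_of R n r B mu f b)).
Proof.
exists 1 => _ [s _ <-]; rewrite /influence_of big_mkcond.
apply: (@le_trans _ _ (\sum_(a : {ffun 'I_r -> G}) \prod_i restricted_measure (mu i) (a i))).
  apply: ler_sum => a _; case: ifP => // _.
  by apply: prodr_ge0 => i _; apply: restricted_ge0.
rewrite -(bigA_distr_bigA (fun i a => restricted_measure (mu i) a)) big1// => i _.
have := @E_restrict R n B (mu i) (fun=> 1); rewrite (E_cst _ (fdist_dist (mu i))) /E => <-.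
by apply: eq_bigr => a _; rewrite mulr1.
Qed.

Lemma val_le_influence : val_of mus B F <= influence B mu f b.
Proof.
have -> : val_of mus B F = influence_of mu f b best_strategy.
  rewrite val_sum /influence_of [RHS]big_mkcond; apply: eq_bigr => a _.
  by rewrite transcript_play /F /output; case: ifP => _; rewrite ?mul1r ?mul0r.
by apply: ub_le_sup; [exact: influence_bounded | exists best_strategy].
Qed.

End Strategies.

(** Serves the case where the claimed size bound is at least n: the set of all players dictates the
    whole transcript. *)
Lemma val_setT (R : realType) (n : nat) (ms : seq (fdist R (bits 'I_n))) (F : seq (bits 'I_n) -> bool) :
  exists b, 1 <= val_of ms [set: 'I_n] (fun t => F t == b).
Proof.
elim: ms F => [|m ms IH] F; first by exists (F [::]); rewrite /= eqxx.
pose y : bits 'I_n := [ffun=> true]; have [b hb] := IH (fun t => F (y :: t)).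
have hy z : pred1 y z -> 1 <= val_of ms [set: 'I_n] (fun t => F (z :: t) == b) by move=> /eqP ->.
exists b; apply: le_trans (val_round (F := fun t => F t == b) m ler01 hy).
rewrite mulr1 (_ : g R (pred1 y) [set: 'I_n] = fun=> 1) ?(E_cst _ (fdist_dist m))//.
apply/funext => x; rewrite /g; suff -> : reach (pred1 y) [set: 'I_n] x by [].
by apply/reachP; exists y; rewrite /= ?eqxx// => i; rewrite inE.
Qed.

(** * Iterated logarithms and towers *)

Section Logs.
Variable R : realType.

Lemma ln2_gt0 : 0 < ln 2 :> R.
Proof. by apply: ln_gt0; rewrite ltr1n. Qed.

Lemma exp2_le_of_log2 (z : nat) (y : R) : 0 < y -> z%:R <= log2 y -> (2 ^ z)%:R <= y.
Proof.
move=> y0; rewrite /log2 ler_pdivlMr ?ln2_gt0// => h.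
rewrite natrX -ler_ln ?posrE ?exprn_gt0//.
by rewrite lnXn//; move: h; rewrite mulr_natl.
Qed.

Lemma tower_le_ilog k (z : nat) (x : R) : ilog_defined k x -> z%:R <= ilog k x ->
  (iter k (expn 2) z)%:R <= x.
Proof.
elim: k z => [|k IH] z // kx zx; rewrite iterSr; apply: IH.
  by move=> j jk; apply: kx; apply: ltnW.
by apply: exp2_le_of_log2; [apply: kx | exact: zx].
Qed.

(** Four exponentials per round are the source of the 4r iterated logarithms. *)
Lemma iter_tower4 k z : iter k tower4 z = iter (4 * k) (expn 2) z.
Proof. by elim: k => // k IH; rewrite mulnS iterD -IH. Qed.

Lemma log2_le0 (y : R) : y <= 1 -> log2 y <= 0.
Proof. by move=> y1; rewrite /log2 pmulr_lle0 ?invr_gt0 ?ln2_gt0// ln_le0. Qed.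

(** At step [logstar x] the value is at most 1, so the next logarithm is not positive; this cannot
    happen while logarithms up to the [k]-th are positive. *)
Lemma leq_logstar k (x : R) : ilog_defined k x -> 0 < ilog k x -> (k <= logstar x)%N.
Proof.
move=> kx k0; rewrite /logstar; case: ex_minnP => m hm _; rewrite leqNgt; apply/negP => mk.
have := log2_le0 hm; apply/negP; rewrite -ltNge -[log2 _]/(ilog m.+1 x).
by move: mk; rewrite leq_eqVlt => /orP[/eqP ->//|]; apply: kx.
Qed.

End Logs.

(** * The bound for r rounds, by comparing n with a tower of height 4r *)

Theorem theorem2 (R : realType) (eps : R) (heps0 : 0 < eps) (heps1 : eps < 1) :
  exists (C : R) (N : nat), 0 < C /\
    forall (n r : nat), (N <= n)%N -> (0 < r)%N -> (r < n)%N ->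
      ilog_defined (4 * r) (n%:R : R) -> 0 < ilog (4 * r) (n%:R : R) ->
    forall (mu : 'I_r -> fdist R (bits 'I_n)),
      (forall i : 'I_r, product_measure (mu i)) ->
    forall f : protocol n r,
    exists (B : {set 'I_n}) (b : bool),
      #|B|%:R <= C * (n%:R * (logstar (n%:R : R))%:R ^+ 2
                      / ilog (4 * r) (n%:R : R)) /\
      1 - eps <= influence B mu f b.
Proof.
(* The summand [2 / eps] pays for the error r/kap0, and 40 makes [kap0] at least 16. *)
exists (2 / eps + 40), 0%N; have e2 : 0 < 2 / eps by rewrite divr_gt0.
split; first by lra.
move=> n r _ r0 rn Ldef L0 mu mup f; set C := 2 / eps + 40.
set L := ilog _ _ in L0 *; set ls := logstar _.
have C40 : 40 < C by rewrite /C; lra.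
have rls : (4 * r <= ls)%N by apply: leq_logstar.
have nR : 0 < n%:R :> R by rewrite ltr0n; apply: leq_ltn_trans rn.
pose l : R := ls%:R; rewrite -/l.
have rl : 4 * r%:R <= l by rewrite /l -natrM ler_nat.
have r1 : 1 <= r%:R :> R by rewrite ler1n.
have l1 : 1 <= l by lra.
have ll : l <= l ^+ 2 by rewrite expr2 ler_peMl//; lra.
pose ms := [seq mu i | i <- enum 'I_r].
have sms : size ms = r by rewrite size_map size_enum_ord.
(* In the first case the claimed bound is at least n, and all players are corrupted. *)
have [small|large] := leP L (C * l ^+ 2).
  have [b hb] := val_setT ms (output f); exists [set: 'I_n], b; split.
    rewrite cardsT card_ord (_ : C * _ = n%:R * (C * l ^+ 2 / L)); last by ring.
    by rewrite ler_peMr ?(ltW nR)// ler_pdivlMr// mul1r.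
  apply: le_trans (val_le_influence _ mu f b); apply: le_trans hb.
  by lra.
have L40 : 40 < L by apply: lt_trans large; nra.
(* As [kap0 <= L], the tower of height 4r over [kap0] is at most n; rounding loses less than a
   factor 2. *)
pose kap0 := Num.truncn L; have /andP[kL Lk] := truncn_itv (ltW L0).
rewrite -/kap0 -natr1 in kL Lk.
have kR : L / 2 < kap0%:R by lra.
have k0R : 0 < kap0%:R :> R by lra.
have k16 : (16 <= kap0)%N by rewrite -(ler_nat R); lra.
have kn : (iter (size ms) tower4 kap0 <= n)%N.
  rewrite sms iter_tower4 -(ler_nat R); exact: tower_le_ilog.
have pms : foldr (fun m P => product_measure m /\ P) True ms.
  by rewrite /ms; elim: (enum 'I_r) => //= i s IH; split.
have [w [s [[w0 w1] sw ss hw]]] := rounds k16 pms kn.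
(* Positive probability yields a controlling coalition in the support of [w], hence one of bounded
   size. *)
have [J [wJ cJ]] : exists J, w J != 0 /\ controls kap0 ms (output f) J.
  apply: contrapT => no; have := hw (output f); apply/negP; rewrite -ltNge.
  rewrite /E big1 => [|J _]; first by rewrite invr_gt0 ltr0n; apply: leq_trans (kap0_le _ _); apply: leq_trans k16.
  have [->|wJ] := eqVneq (w J) 0; first by rewrite mul0r.
  case: (boolP (controls kap0 ms (output f) J)) => cJ; last by rewrite mulr0.
  by case: no; exists J.
have [b hb] := existsP cJ; exists J, b.
have Js : (kap0 * #|J| <= r * (2 * n))%N.
  by rewrite -sms; apply: leq_trans ss; rewrite leq_mul2l sw ?orbT.
have JR : kap0%:R * #|J|%:R <= r%:R * (2 * n%:R) :> R by rewrite -!natrM ler_nat.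
(* The error: r <= l/4 and kap0 > L/2 >= l^2/eps give r/kap0 <= eps. *)
split; last first.
  apply: le_trans (val_le_influence _ mu f b); apply: le_trans hb.
  rewrite sms lerD2l lerN2 ler_pdivrMr//.
  have h1 : 2 / eps * l ^+ 2 <= L by apply: le_trans (ltW large); rewrite ler_wpM2r ?sqr_ge0// /C; lra.
  have h2 : eps * (2 / eps * l ^+ 2) <= eps * L by rewrite ler_pM2l.
  have h3 : eps * (2 / eps * l ^+ 2) = 2 * l ^+ 2 by field; lra.
  have h4 : eps * (L / 2) <= eps * kap0%:R by rewrite ler_pM2l// ltW.
  by lra.
(* The size: |J| <= 2rn/kap0 <= 4rn/L, and 4r <= l <= l^2. *)
rewrite mulrA ler_pdivlMr//; apply: (@le_trans _ _ (#|J|%:R * (2 * kap0%:R))).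
  by apply: ler_wpM2l => //; lra.
apply: (@le_trans _ _ (n%:R * (4 * r%:R))); first by lra.
apply: (@le_trans _ _ (n%:R * l ^+ 2)); first by rewrite ler_pM2l//; lra.
apply: ler_peMl; last by lra.
by rewrite mulr_ge0 ?sqr_ge0// ltW.
Qed.
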